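(* Let $(B,\langle|\rangle,\beta)$ be a cotriangular Hom-Hopf algebra and $(H,\alpha)$ a Hom-Hopf algebra. Then the category ${}^{B}\mathbb{M}$ of left $(B,\beta)$-Hom-comodules is a symmetric subcategory of the category ${}^{B}_{H}\mathbb{L}$ of left-left $(H,B)$-Hom-Long dimodules under the left $(H,\alpha)$-module action $h\cdot m=\epsilon(h)\mu(m)$ for $h\in H$, $m\in(M,\mu)\in{}^{B}\mathbb{M}$, where the (symmetric) braiding on ${}^{B}\mathbb{M}$ is given by $$C_{M,N}:M\otimes N\to N\otimes M,\qquad m\otimes n\mapsto\langle m_{(-1)}|n_{(-1)}\rangle\,\nu^{-1}(n_{(0)})\otimes\mu^{-1}(m_{(0)}),$$ for all $m\in(M,\mu)\in{}^{B}\mathbb{M}$, $n\in(N,\nu)\in{}^{B}\mathbb{M}$.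
   Context: All vector spaces, maps and tensor products are over a fixed field $k$; Sweedler notation $\Delta(c)=c_1\otimes c_2$ is used, and $\rho(m)=m_{(-1)}\otimes m_{(0)}$ for coactions. A Hom-algebra $(A,\mu_A,1_A,\alpha)$: a linear space $A$ with a linear multiplication, $1_A\in A$ and a linear bijection $\alpha:A\to A$ with $\alpha(aa')=\alpha(a)\alpha(a')$, $\alpha(1_A)=1_A$, $\alpha(a)(a'a'')=(aa')\alpha(a'')$, $a1_A=1_Aa=\alpha(a)$. A left $(A,\alpha)$-Hom-module $(M,\cdot,\mu)$: a linear space $M$, linear $\cdot:A\otimes M\to M$, and a linear bijection $\mu:M\to M$ with $\mu(a\cdot m)=\alpha(a)\cdot\mu(m)$, $\alpha(a)\cdot(a'\cdot m)=(aa')\cdot\mu(m)$, $1_A\cdot m=\mu(m)$. Morphisms are linear maps $f$ with $f(a\cdot m)=a\cdot f(m)$ commuting with the structure maps. A Hom-coalgebra $(C,\Delta,\epsilon,\beta)$: linear $\Delta:C\to C\otimes C$, $\epsilon:C\to k$, and a linear bijection $\beta$ with $\Delta(\beta(c))=\beta(c_1)\otimes\beta(c_2)$, $\epsilon\circ\beta=\epsilon$, $\beta(c_1)\otimes c_{21}\otimes c_{22}=c_{11}\otimes c_{12}\otimes\beta(c_2)$, $\epsilon(c_1)c_2=c_1\epsilon(c_2)=\beta(c)$. A left $(C,\beta)$-Hom-comodule $(M,\rho,\mu)$: linear $\rho:M\to C\otimes M$ and a linear bijection $\mu$ with $\rho(\mu(m))=\beta(m_{(-1)})\otimes\mu(m_{(0)})$,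 $\epsilon(m_{(-1)})m_{(0)}=\mu(m)$, $\beta(m_{(-1)})\otimes m_{(0)(-1)}\otimes m_{(0)(0)}=m_{(-1)1}\otimes m_{(-1)2}\otimes\mu(m_{(0)})$. Morphisms are colinear maps commuting with the structure maps. A Hom-bialgebra $(H,\alpha)$: a Hom-algebra and Hom-coalgebra with the same structure map $\alpha$ such that $\Delta(hh')=\Delta(h)\Delta(h')$, $\Delta(1)=1\otimes1$, $\epsilon(hh')=\epsilon(h)\epsilon(h')$, $\epsilon(1)=1$. It is a Hom-Hopf algebra if there is a linear map $S:H\to H$ (antipode) with $S(h_1)h_2=h_1S(h_2)=\epsilon(h)1_H$ and $S\circ\alpha=\alpha\circ S$. A coquasitriangular Hom-Hopf algebra $(B,\langle|\rangle,\beta)$: a Hom-Hopf algebra $(B,\beta)$ with a bilinear form $\langle|\rangle:B\otimes B\to k$ such that for all $h,g,l\in B$: $\langle hg|\beta(l)\rangle=\langle\beta(h)|l_2\rangle\langle\beta(g)|l_1\rangle$; $\langle\beta(h)|gl\rangle=\langle h_1|\beta(g)\rangle\langle h_2|\beta(l)\rangle$; $\langle h_1|g_1\rangle g_2h_2=h_1g_1\langle h_2|g_2\rangle$; $\langle1|h\rangle=\langle h|1\rangle=\epsilon(h)$; $\langle\beta(h)|\beta(g)\rangle=\langle h|g\rangle$. It is cotriangular if $\langle h_1|g_1\rangle\langle g_2|h_2\rangle=\epsilon(h)\epsilon(g)$ for all $h,g\in B$. A left-left $(H,B)$-Hom-Long dimodule $(M,\cdot,\rho,\mu)$: $(M,\cdot,\mu)$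 is a left $(H,\alpha)$-Hom-module and $(M,\rho,\mu)$ is a left $(B,\beta)$-Hom-comodule with $\rho(h\cdot m)=\beta(m_{(-1)})\otimes\alpha(h)\cdot m_{(0)}$. The category ${}^{B}_{H}\mathbb{L}$ has these as objects and, as morphisms, the $H$-linear $B$-colinear maps commuting with structure maps. Monoidal structure on ${}^{B}_{H}\mathbb{L}$: for $(M,\mu),(N,\nu)$, the tensor product is $(M\otimes N,\mu\otimes\nu)$ with $h\cdot(m\otimes n)=h_1\cdot m\otimes h_2\cdot n$ and $\rho(m\otimes n)=\beta^{-2}(m_{(-1)}n_{(-1)})\otimes m_{(0)}\otimes n_{(0)}$; the unit is $I=(k,\mathrm{id})$ with $h\cdot 1=\epsilon(h)$, $\rho(1)=1_B\otimes1$; for $(U,\mu),(V,\nu),(W,\omega)$ the associator is $a_{U,V,W}((u\otimes v)\otimes w)=\mu^{-1}(u)\otimes(v\otimes\omega(w))$, and the unit constraints are $l_V(\lambda\otimes v)=\lambda\nu^{-1}(v)$, $r_V(v\otimes\lambda)=\lambda\nu^{-1}(v)$ for $\lambda\in k$. A braiding $C$ on a monoidal category is a symmetry if $C_{Y,X}\circ C_{X,Y}=id_{X\otimes Y}$ for all $X,Y$; the category is then called symmetric. *)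

(* Defs.v *)
From HB Require Import structures.
From mathcomp Require Import all_boot all_algebra generic_quotient.
From mathcomp Require Import boolp.

Set Implicit Arguments.
Unset Strict Implicit.
Unset Printing Implicit Defensive.

Import GRing.Theory.
Local Open Scope ring_scope.
Local Open Scope quotient_scope.

Section TensorProduct.
Variables (k : fieldType) (M N : lmodType k).
Implicit Types s : seq (M * N).

(* A finite sequence of pairs (m, n) stands for the formal sum of the m (x) n.
   Two formal sums are identified when no bilinear map can separate them. *)
Definition tequiv s t : bool :=
  `[< forall (P : lmodType k) (f : {bilinear M -> N -> P}),
        \sum_(x <- s) f x.1 x.2 = \sum_(x <- t) f x.1 x.2 >].

Lemma tequiv_is_equiv : equiv_class_of tequiv.
Proof.
split=> [s|s t|t s u]; first exact/asboolP.
- by apply: asbool_equiv_eq; split=> h P f; rewrite h.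
- by move=> /asboolP h1 /asboolP h2; apply/asboolP=> P f; rewrite h1.
Qed.
Canonical tequiv_equiv := EquivRelPack tequiv_is_equiv.

Definition tensor := {eq_quot tequiv}.
HB.instance Definition _ := Choice.on tensor.
HB.instance Definition _ := Quotient.on tensor.

Definition tpure (m : M) (n : N) : tensor := \pi_tensor [:: (m, n)].

(* Sweedler-style sum: if t is the sum of the m_i (x) n_i, tsum f t is the sum
   of the f m_i n_i. This is independent of the decomposition of t only when f
   is bilinear (tsum_pure, tsum_linear), in which case tsum f is the linear map
   on the tensor product induced by f. *)
Definition tsum (P : nmodType) (f : M -> N -> P) (t : tensor) : P :=
  \sum_(x <- (repr t : seq (M * N))) f x.1 x.2.

Definition tadd (t u : tensor) : tensor :=
  \pi_tensor ((repr t : seq (M * N)) ++ repr u).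
Definition tscale (c : k) (t : tensor) : tensor :=
  \pi_tensor [seq (c *: x.1, x.2) | x <- (repr t : seq (M * N))].
Definition tzero : tensor := \pi_tensor [::].

Lemma tsum_pi (P : lmodType k) (f : {bilinear M -> N -> P}) s :
  tsum f (\pi_tensor s) = \sum_(x <- s) f x.1 x.2.
Proof.
have /eqquotP/asboolP h : repr (\pi_tensor s) = s %[mod tensor] by rewrite reprK.
exact: h.
Qed.

Lemma tensor_eq (t u : tensor) :
  (forall (P : lmodType k) (f : {bilinear M -> N -> P}), tsum f t = tsum f u) ->
  t = u.
Proof.
move=> h; rewrite -[t]reprK -[u]reprK; apply/eqquotP/asboolP => P f.
exact: h.
Qed.

Lemma tsum_add (P : lmodType k) (f : {bilinear M -> N -> P}) t u :
  tsum f (tadd t u) = tsum f t + tsum f u.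
Proof. by rewrite tsum_pi big_cat. Qed.

Lemma tsum_scale (P : lmodType k) (f : {bilinear M -> N -> P}) c t :
  tsum f (tscale c t) = c *: tsum f t.
Proof.
rewrite tsum_pi big_map scaler_sumr; apply: eq_bigr => x _ /=.
by rewrite linearZl_LR.
Qed.

Lemma tsum_zero (P : lmodType k) (f : {bilinear M -> N -> P}) :
  tsum f tzero = 0.
Proof. by rewrite tsum_pi big_nil. Qed.

Lemma taddA : associative tadd.
Proof. by move=> t u v; apply: tensor_eq => P f; rewrite !tsum_add addrA. Qed.
Lemma taddC : commutative tadd.
Proof. by move=> t u; apply: tensor_eq => P f; rewrite !tsum_add addrC. Qed.
Lemma tadd0 : left_id tzero tadd.
Proof. by move=> t; apply: tensor_eq => P f; rewrite tsum_add tsum_zero add0r. Qed.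
Lemma taddN : left_inverse tzero (tscale (-1)) tadd.
Proof.
move=> t; apply: tensor_eq => P f.
by rewrite tsum_add tsum_scale tsum_zero scaleN1r addNr.
Qed.
HB.instance Definition _ := GRing.isZmodule.Build tensor taddA taddC tadd0 taddN.

Lemma tscaleA a b t : tscale a (tscale b t) = tscale (a * b) t.
Proof. by apply: tensor_eq => P f; rewrite !tsum_scale scalerA. Qed.
Lemma tscale1 : left_id 1 tscale.
Proof. by move=> t; apply: tensor_eq => P f; rewrite tsum_scale scale1r. Qed.
Lemma tscaleDr : right_distributive tscale +%R.
Proof.
move=> a t u; apply: tensor_eq => P f.
by rewrite tsum_add !tsum_scale tsum_add scalerDr.
Qed.
Lemma tscaleDl t : {morph tscale^~ t : a b / a + b}.
Proof.
by move=> a b; apply: tensor_eq => P f; rewrite tsum_add !tsum_scale scalerDl.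
Qed.
HB.instance Definition _ :=
  GRing.Zmodule_isLmodule.Build k tensor tscaleA tscale1 tscaleDr tscaleDl.

Definition bilin (P : lmodType k) (f : M -> N -> P) : Prop :=
  (forall n, linear (f^~ n)) /\ (forall m, linear (f m)).

Lemma bilin_bilinear (P : lmodType k) (f : M -> N -> P) :
  bilin f -> exists g : {bilinear M -> N -> P}, f = g.
Proof.
move=> [h1 h2].
pose g : {bilinear M -> N -> P} :=
  HB.pack f (bilinear_isBilinear.Build k M N P *:%R *:%R f (h1, h2)).
by exists g.
Qed.

Lemma bilinear_bilin (P : lmodType k) (f : {bilinear M -> N -> P}) : bilin f.
Proof.
by split=> [n|m] a u v /=; [rewrite linearPl|rewrite linearPr].
Qed.

Lemma tpure_bilin : bilin tpure.
Proof.
split=> [n|m] a u v; apply: tensor_eq => P f.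
- rewrite /= tsum_add tsum_scale !tsum_pi !big_seq1 /=.
  by rewrite linearPl.
- rewrite /= tsum_add tsum_scale !tsum_pi !big_seq1 /=.
  by rewrite linearPr.
Qed.

HB.instance Definition _ := bilinear_isBilinear.Build k M N tensor *:%R *:%R tpure
  (tpure_bilin.1, tpure_bilin.2).

Lemma tsum_pure (P : lmodType k) (f : M -> N -> P) m n :
  bilin f -> tsum f (tpure m n) = f m n.
Proof. by case/bilin_bilinear=> g ->; rewrite tsum_pi big_seq1. Qed.

Lemma tsum_linear (P : lmodType k) (f : M -> N -> P) :
  bilin f -> linear (tsum f).
Proof.
by case/bilin_bilinear=> g -> a t u; rewrite [LHS]tsum_add tsum_scale.
Qed.

Lemma tensor_sum (t : tensor) : t = tsum tpure t.
Proof.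
apply: tensor_eq => P f.
have [g e] : exists g : {linear tensor -> P}, tsum f =1 g.
  have h := tsum_linear (bilinear_bilin f).
  pose g : {linear tensor -> P} :=
    HB.pack (tsum f) (GRing.isLinear.Build k _ _ _ _ h).
  by exists g.
rewrite [RHS]e {2}/tsum linear_sum; apply: eq_bigr => x _.
by rewrite -e tsum_pure //; apply: bilinear_bilin.
Qed.

Lemma tensor_ext (P : lmodType k) (f g : tensor -> P) :
  linear f -> linear g -> (forall m n, f (tpure m n) = g (tpure m n)) -> f =1 g.
Proof.
move=> lf lg h t.
pose f' : {linear tensor -> P} := HB.pack f (GRing.isLinear.Build k _ _ _ _ lf).
pose g' : {linear tensor -> P} := HB.pack g (GRing.isLinear.Build k _ _ _ _ lg).
rewrite -[f]/(f' : _ -> _) -[g]/(g' : _ -> _) (tensor_sum t) /tsum !linear_sum.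
by apply: eq_bigr => x _; apply: h.
Qed.

End TensorProduct.

Arguments tpure {k M N} m n.
Arguments tsum {k M N P} f t.

Notation "m ⊗ n" := (tpure m n) (at level 38, left associativity) : ring_scope.
Notation "'\tsum_' ( a , b <- t ) E" := (tsum (fun a b => E) t)
  (at level 41, E at level 41, a name, b name,
   format "'[' '\tsum_' ( a ,  b  <-  t ) '/  '  E ']'") : ring_scope.

Section Linearity.
Variables (k : fieldType) (U : lmodType k).

Lemma lin_id : linear (fun x : U => x). Proof. by []. Qed.

Lemma lin_comp (V W : lmodType k) (L : {linear V -> W}) (g : U -> V) :
  linear g -> linear (fun x => L (g x)).
Proof. by move=> h a u v; rewrite h linearP. Qed.

Lemma lin_scal (V : lmodType k) (L : {scalar V}) (g : U -> V) :
  linear g -> linear (fun x => L (g x) : k^o).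
Proof. by move=> h a u v; rewrite h linearP. Qed.

Lemma lin_bil_l (V V' W : lmodType k) (f : {bilinear V -> V' -> W}) (g : U -> V) n :
  linear g -> linear (fun x => f (g x) n).
Proof. by move=> h a u v; rewrite h linearPl. Qed.

Lemma lin_bil_r (V V' W : lmodType k) (f : {bilinear V -> V' -> W}) (g : U -> V') m :
  linear g -> linear (fun x => f m (g x)).
Proof. by move=> h a u v; rewrite h linearPr. Qed.

Lemma lin_bisc_l (V : lmodType k) (f : {biscalar V}) (g : U -> V) n :
  linear g -> linear (fun x => f (g x) n : k^o).
Proof. by move=> h a u v; rewrite h linearPl. Qed.

Lemma lin_bisc_r (V : lmodType k) (f : {biscalar V}) (g : U -> V) m :
  linear g -> linear (fun x => f m (g x) : k^o).
Proof. by move=> h a u v; rewrite h linearPr. Qed.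

Lemma lin_pure_l (V W : lmodType k) (g : U -> V) (n : W) :
  linear g -> linear (fun x => g x ⊗ n).
Proof. by move=> h a u v; rewrite h linearPl. Qed.

Lemma lin_pure_r (V W : lmodType k) (g : U -> V) (m : W) :
  linear g -> linear (fun x => m ⊗ g x).
Proof. by move=> h a u v; rewrite h linearPr. Qed.

Lemma lin_tsum_t (V W P : lmodType k) (F : V -> W -> P) (g : U -> tensor V W) :
  bilin F -> linear g -> linear (fun x => tsum F (g x)).
Proof. by move=> hF h a u v; rewrite h (tsum_linear hF). Qed.

Lemma lin_tsum_f (V W P : lmodType k) (F : U -> V -> W -> P) (t : tensor V W) :
  (forall a b, linear (fun x => F x a b)) -> linear (fun x => tsum (F x) t).
Proof.
move=> h a u v; rewrite /tsum scaler_sumr -big_split; apply: eq_bigr => x _ /=.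
exact: h.
Qed.

Lemma lin_scale_l (V : lmodType k) (g : U -> k) (v : V) :
  linear (g : U -> k^o) -> linear (fun x => g x *: v).
Proof. by move=> h a x y; rewrite h scalerDl scalerA. Qed.

Lemma lin_scale_r (V : lmodType k) (g : U -> V) (c : k) :
  linear g -> linear (fun x => c *: g x).
Proof. by move=> h a x y; rewrite h scalerDr !scalerA mulrC. Qed.

Lemma lin_mul_l (g : U -> k) (c : k) :
  linear (g : U -> k^o) -> linear ((fun x => g x * c) : U -> k^o).
Proof. by move=> h a x y; rewrite h mulrDl -[_ *: _ in RHS]/(_ * _) -mulrA. Qed.

Lemma lin_mul_r (g : U -> k) (c : k) :
  linear (g : U -> k^o) -> linear ((fun x => c * g x) : U -> k^o).
Proof. by move=> h a x y; rewrite h mulrDr -[_ *: _ in RHS]/(_ * _) mulrCA. Qed.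

End Linearity.

Ltac lin := intros; cbv beta; lazymatch goal with
  | |- bilin _ => split; lin
  | |- GRing.linear_for _ (fun x => x) => exact: lin_id
  | |- GRing.linear_for _ (fun x => tsum _ _) =>
     first [apply: lin_tsum_f | apply: lin_tsum_t]; lin
  | |- GRing.linear_for _ (fun x => _ ⊗ _) =>
     first [apply: lin_pure_l | apply: lin_pure_r]; lin
  | |- GRing.linear_for _ (fun x => _ *: _) =>
     first [apply: lin_scale_l | apply: lin_scale_r]; lin
  | |- GRing.linear_for _ (fun x => _ * _) =>
     first [apply: lin_mul_l | apply: lin_mul_r]; lin
  | |- GRing.linear_for _ (fun x => Bilinear.sort _ _ _) =>
     first [apply: lin_bil_l | apply: lin_bil_r
           | apply: lin_bisc_l | apply: lin_bisc_r]; lin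
  | |- GRing.linear_for _ (fun x => GRing.Linear.sort _ _) =>
     first [apply: lin_comp | apply: lin_scal]; lin
  | |- GRing.linear_for _ (fun x => _) => fail
  | |- GRing.linear_for ?s ?f => change (GRing.linear_for s (fun x => f x)); lin
  | |- _ => solve [eauto]
  end.

Section Sums.
Variables (k : fieldType).

Lemma eq_tsum (M N : lmodType k) (P : nmodType) (F G : M -> N -> P) t :
  (forall a b, F a b = G a b) -> tsum F t = tsum G t.
Proof. by move=> h; apply: eq_bigr => x _. Qed.

Lemma tsum_id (M N : lmodType k) (t : tensor M N) : \tsum_(a, b <- t) a ⊗ b = t.
Proof. by rewrite [RHS]tensor_sum. Qed.

Lemma tsum_tsum (M N V W P : lmodType k) (F : V -> W -> P)
    (G : M -> N -> tensor V W) t : bilin F ->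
  tsum F (tsum G t) = \tsum_(a, b <- t) tsum F (G a b).
Proof.
move=> h; pose L : {linear _ -> _} :=
  HB.pack (tsum F) (GRing.isLinear.Build k _ _ _ _ (tsum_linear h)).
exact: (linear_sum L).
Qed.

Lemma lin_tsum (M N V P : lmodType k) (L : V -> P) (G : M -> N -> V) t :
  linear L -> L (tsum G t) = \tsum_(a, b <- t) L (G a b).
Proof.
move=> h; pose L' : {linear _ -> _} := HB.pack L (GRing.isLinear.Build k _ _ _ _ h).
exact: (linear_sum L').
Qed.

Lemma tsumZ (M N V : lmodType k) (G : M -> N -> V) (c : k) t :
  c *: tsum G t = \tsum_(a, b <- t) c *: G a b.
Proof. exact: scaler_sumr. Qed.

Lemma exchange_tsum (M N V W : lmodType k) (P : nmodType)
    (F : M -> N -> V -> W -> P) t u :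
  \tsum_(a, b <- t) \tsum_(c, d <- u) F a b c d =
  \tsum_(c, d <- u) \tsum_(a, b <- t) F a b c d.
Proof. exact: exchange_big. Qed.

End Sums.

Arguments eq_tsum {k M N P F} G {t}.

Definition mklin (k : fieldType) (V W : lmodType k) (f : V -> W) (h : linear f) :
  {linear V -> W} := HB.pack f (GRing.isLinear.Build k V W *:%R f h).

Lemma mklinE (k : fieldType) (V W : lmodType k) (f : V -> W) (h : linear f) x :
  mklin h x = f x.
Proof. by []. Qed.

Definition mkbil (k : fieldType) (U V W : lmodType k) (f : U -> V -> W)
    (h : bilin f) : {bilinear U -> V -> W} :=
  HB.pack f (bilinear_isBilinear.Build k U V W *:%R *:%R f (h.1, h.2)).

Lemma eq_linfun (k : fieldType) (V W : lmodType k) (f g : {linear V -> W}) :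
  f =1 g -> f = g.
Proof.
case: f g => [f [[cf1] [cf2]]] [g [[cg1] [cg2]]] /= /funext e; subst g.
by rewrite (Prop_irrelevance cf1 cg1) (Prop_irrelevance cf2 cg2).
Qed.

(* A linear bijection, bundled with its inverse f⁻¹. *)
Record linAut (k : fieldType) (V : lmodType k) := LinAut {
  aut :> {linear V -> V};
  auti : {linear V -> V};
  autK : cancel aut auti;
  autVK : cancel auti aut
}.
Notation "f ⁻¹" := (auti f) (at level 2, format "f ⁻¹") : ring_scope.

Section TensorMaps.
Variable k : fieldType.

Lemma tmap_linear (M N V W : lmodType k) (f : {linear M -> V}) (g : {linear N -> W}) :
  linear (fun t : tensor M N => \tsum_(m, n <- t) f m ⊗ g n).
Proof. by lin. Qed.
Definition tmap (M N V W : lmodType k) f g : {linear tensor M N -> tensor V W} :=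
  mklin (tmap_linear f g).

Lemma tmapE (M N V W : lmodType k) (f : {linear M -> V}) (g : {linear N -> W}) m n :
  tmap f g (m ⊗ n) = f m ⊗ g n.
Proof. by rewrite /tmap /= tsum_pure //; lin. Qed.
Arguments tmap : simpl never.

Lemma taut_subproof (M N : lmodType k) (f f' : {linear M -> M})
  (g g' : {linear N -> N}) : cancel f f' -> cancel g g' ->
  cancel (tmap f g) (tmap f' g').
Proof.
move=> fK gK t; rewrite /tmap /= tsum_tsum; last by lin.
rewrite -[RHS]tsum_id; apply: eq_tsum => a b.
by rewrite tsum_pure ?fK ?gK //; lin.
Qed.

Definition taut (M N : lmodType k) (f : linAut M) (g : linAut N) :
    linAut (tensor M N) :=
  LinAut (taut_subproof (@autK _ _ f) (@autK _ _ g))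
         (taut_subproof (@autVK _ _ f) (@autVK _ _ g)).

Lemma tautE (M N : lmodType k) (f : linAut M) (g : linAut N) m n :
  taut f g (m ⊗ n) = f m ⊗ g n.
Proof. exact: tmapE. Qed.

Definition idaut (V : lmodType k) : linAut V :=
  @LinAut k V idfun idfun (fun _ => erefl) (fun _ => erefl).

Lemma idautE (V : lmodType k) (v : V) : idaut V v = v.
Proof. by []. Qed.

End TensorMaps.

Section HomStructures.
Variable k : fieldType.

Record is_homAlgebra (A : lmodType k) (mul : {bilinear A -> A -> A}) (one : A)
    (alpha : linAut A) : Prop := IsHomAlgebra {
  halg_autM : forall a b, alpha (mul a b) = mul (alpha a) (alpha b);
  halg_aut1 : alpha one = one;
  halg_assoc : forall a b c,
    mul (alpha a) (mul b c) = mul (mul a b) (alpha c);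
  halg_mulr1 : forall a, mul a one = alpha a;
  halg_mul1r : forall a, mul one a = alpha a
}.

Record is_homModule (A : lmodType k) (mul : {bilinear A -> A -> A}) (one : A)
    (alpha : linAut A) (M : lmodType k) (act : {bilinear A -> M -> M})
    (mu : linAut M) : Prop := IsHomModule {
  hmod_aut : forall a m, mu (act a m) = act (alpha a) (mu m);
  hmod_assoc : forall a b m,
    act (alpha a) (act b m) = act (mul a b) (mu m);
  hmod_act1 : forall m, act one m = mu m
}.

Record is_homCoalgebra (C : lmodType k) (Delta : {linear C -> tensor C C})
    (eps : {scalar C}) (beta : linAut C) : Prop := IsHomCoalgebra {
  hcoalg_aut : forall c,
    Delta (beta c) = \tsum_(c1, c2 <- Delta c) beta c1 ⊗ beta c2;
  hcoalg_counit_aut : forall c, eps (beta c) = eps c;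
  hcoalg_coassoc : forall c,
    \tsum_(c1, c2 <- Delta c) beta c1 ⊗ Delta c2 =
    \tsum_(c1, c2 <- Delta c) \tsum_(c11, c12 <- Delta c1)
       c11 ⊗ (c12 ⊗ beta c2);
  hcoalg_counitl : forall c, \tsum_(c1, c2 <- Delta c) eps c1 *: c2 = beta c;
  hcoalg_counitr : forall c, \tsum_(c1, c2 <- Delta c) eps c2 *: c1 = beta c
}.

Record is_homComodule (C : lmodType k) (Delta : {linear C -> tensor C C})
    (eps : {scalar C}) (beta : linAut C) (M : lmodType k)
    (rho : {linear M -> tensor C M}) (mu : linAut M) : Prop := IsHomComodule {
  hcomod_aut : forall m,
    rho (mu m) = \tsum_(c, x <- rho m) beta c ⊗ mu x;
  hcomod_counit : forall m, \tsum_(c, x <- rho m) eps c *: x = mu m;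
  hcomod_coassoc : forall m,
    \tsum_(c, x <- rho m) beta c ⊗ rho x =
    \tsum_(c, x <- rho m) \tsum_(c1, c2 <- Delta c) c1 ⊗ (c2 ⊗ mu x)
}.

Record homBialgebra := HomBialgebra {
  bcar :> lmodType k;
  bmul : {bilinear bcar -> bcar -> bcar};
  bone : bcar;
  bcomul : {linear bcar -> tensor bcar bcar};
  bcounit : {scalar bcar};
  baut : linAut bcar;
  balgP : is_homAlgebra bmul bone baut;
  bcoalgP : is_homCoalgebra bcomul bcounit baut;
  bcomulM : forall g h, bcomul (bmul g h) =
    \tsum_(g1, g2 <- bcomul g) \tsum_(h1, h2 <- bcomul h)
      bmul g1 h1 ⊗ bmul g2 h2;
  bcomul1 : bcomul bone = bone ⊗ bone;
  bcounitM : forall g h, bcounit (bmul g h) = bcounit g * bcounit h;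
  bcounit1 : bcounit bone = 1
}.

Arguments bmul {_}.
Arguments bcomul {_}.
Arguments bcounit {_}.

Record homHopf := HomHopf {
  hopf_bialg :> homBialgebra;
  antipode : {linear hopf_bialg -> hopf_bialg};
  antipodel : forall h,
    \tsum_(h1, h2 <- bcomul h) bmul (antipode h1) h2 =
    bcounit h *: bone hopf_bialg;
  antipoder : forall h,
    \tsum_(h1, h2 <- bcomul h) bmul h1 (antipode h2) =
    bcounit h *: bone hopf_bialg;
  antipode_aut : forall h,
    antipode (baut hopf_bialg h) = baut hopf_bialg (antipode h)
}.

Arguments antipode {_}.

Record cqtHomHopf := CqtHomHopf {
  cqt_hopf :> homHopf;
  bform : {biscalar cqt_hopf};
  bformMl : forall h g l,
    bform (bmul h g) (baut cqt_hopf l) =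
    \tsum_(l1, l2 <- bcomul l)
      bform (baut cqt_hopf h) l2 * bform (baut cqt_hopf g) l1;
  bformMr : forall h g l,
    bform (baut cqt_hopf h) (bmul g l) =
    \tsum_(h1, h2 <- bcomul h)
      bform h1 (baut cqt_hopf g) * bform h2 (baut cqt_hopf l);
  bform_comm : forall h g,
    \tsum_(h1, h2 <- bcomul h) \tsum_(g1, g2 <- bcomul g)
      bform h1 g1 *: bmul g2 h2 =
    \tsum_(h1, h2 <- bcomul h) \tsum_(g1, g2 <- bcomul g)
      bform h2 g2 *: bmul h1 g1;
  bform1l : forall h, bform (bone cqt_hopf) h = bcounit h;
  bform1r : forall h, bform h (bone cqt_hopf) = bcounit h;
  bform_aut : forall h g,
    bform (baut cqt_hopf h) (baut cqt_hopf g) = bform h g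
}.

Arguments bform {_}.

Definition cotriangular (B : cqtHomHopf) : Prop := forall h g : B,
  \tsum_(h1, h2 <- bcomul h) \tsum_(g1, g2 <- bcomul g)
    bform h1 g1 * bform g2 h2 = bcounit h * bcounit g.

(* The structure map of a comodule (or dimodule) M is maut M. *)
Record homComodule (B : homBialgebra) := HomComodule {
  mcar :> lmodType k;
  mrho : {linear mcar -> tensor B mcar};
  maut : linAut mcar;
  mcomodP : is_homComodule (@bcomul B) (@bcounit B) (baut B) mrho maut
}.

Arguments mrho {_ _}.
Arguments maut {_} _.

Record is_homLong (H B : homBialgebra) (M : homComodule B)
    (act : {bilinear H -> M -> M}) : Prop := IsHomLong {
  hlong_mod : is_homModule (@bmul H) (bone H) (baut H) act (maut M);
  hlong_compat : forall h m,
    mrho (act h m) = \tsum_(b, x <- mrho m) baut B b ⊗ act (baut H h) x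
}.

Record homLong (H B : homBialgebra) := HomLong {
  long_comod :> homComodule B;
  lact : {bilinear H -> long_comod -> long_comod};
  longP : is_homLong lact
}.

Arguments lact {_ _ _}.

Record comodHom (B : homBialgebra) (M N : homComodule B) := ComodHom {
  chom :> {linear M -> N};
  chom_colinear : forall m,
    mrho (chom m) = \tsum_(b, x <- mrho m) b ⊗ chom x;
  chom_aut : forall m, chom (maut M m) = maut N (chom m)
}.

Record longHom (H B : homBialgebra) (M N : homLong H B) := LongHom {
  lhom :> comodHom M N;
  lhom_act : forall h m, lhom (lact h m) = lact h (lhom m)
}.

End HomStructures.

Arguments homComodule {k} B.
Arguments homLong {k} H B.
Arguments bmul {k _}.
Arguments bone {k} _.
Arguments baut {k} _.
Arguments bcomul {k _}.
Arguments bcounit {k _}.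
Arguments antipode {k _}.
Arguments bform {k _}.
Arguments mrho {k _ _}.
Arguments maut {k _} _.
Arguments lact {k _ _ _}.

Ltac tens_ext := match goal with
  | |- forall t, @?f t = @?g t =>
    apply: (@tensor_ext _ _ _ _ f g); [by lin | by lin | cbv beta]
  end.

Lemma tpureZl (k : fieldType) (M N : lmodType k) c (m : M) (n : N) :
  (c *: m) ⊗ n = c *: (m ⊗ n).
Proof. exact: (linearZl_LR (@tpure k M N)). Qed.
Lemma tpureZr (k : fieldType) (M N : lmodType k) c (m : M) (n : N) :
  m ⊗ (c *: n) = c *: (m ⊗ n).
Proof. exact: (linearZr_LR (@tpure k M N)). Qed.

Section Sweedler.
Variables (k : fieldType) (H B : homBialgebra k).

Definition trilin (U V W P : lmodType k) (F : U -> V -> W -> P) : Prop :=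
  (forall a, bilin (F a)) /\ (forall b c, linear (fun a => F a b c)).

Lemma baut_inj : injective (baut B). Proof. exact: can_inj (@autK _ _ (baut B)). Qed.

Lemma bmul_auti (g h : B) : (baut B)⁻¹ (bmul g h) = bmul ((baut B)⁻¹ g) ((baut B)⁻¹ h).
Proof. by apply: baut_inj; rewrite (halg_autM (balgP B)) !autVK. Qed.

Lemma bcounit_auti (c : B) : bcounit ((baut B)⁻¹ c) = bcounit c.
Proof. by rewrite -(hcoalg_counit_aut (bcoalgP B)) autVK. Qed.

Lemma bone_auti : (baut B)⁻¹ (bone B) = bone B.
Proof. by apply: baut_inj; rewrite (halg_aut1 (balgP B)) autVK. Qed.

Section Comul.
Variable (P : lmodType k).

Lemma sw_comul_aut (F : B -> B -> P) c : bilin F ->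
  tsum F (bcomul (baut B c)) = \tsum_(c1, c2 <- bcomul c) F (baut B c1) (baut B c2).
Proof.
move=> h; rewrite (hcoalg_aut (bcoalgP B)) tsum_tsum //.
by apply: eq_tsum => a b; rewrite tsum_pure.
Qed.

Lemma sw_comul_auti (F : B -> B -> P) c : bilin F ->
  tsum F (bcomul ((baut B)⁻¹ c)) =
  \tsum_(c1, c2 <- bcomul c) F ((baut B)⁻¹ c1) ((baut B)⁻¹ c2).
Proof.
move=> [h1 h2]; rewrite -[in RHS](@autVK _ _ (baut B) c) sw_comul_aut.
  by apply: eq_tsum => a b; rewrite !autK.
by split=> [b|a] x u v /=; rewrite linearP; [apply: h1 | apply: h2].
Qed.

Lemma sw_comul_mul (F : B -> B -> P) g h : bilin F ->
  tsum F (bcomul (bmul g h)) =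
  \tsum_(g1, g2 <- bcomul g) \tsum_(h1, h2 <- bcomul h) F (bmul g1 h1) (bmul g2 h2).
Proof.
move=> hF; rewrite bcomulM tsum_tsum //; apply: eq_tsum => a b.
by rewrite tsum_tsum //; apply: eq_tsum => c d; rewrite tsum_pure.
Qed.

Lemma sw_comul_coassoc (F : B -> B -> B -> P) c : trilin F ->
  \tsum_(c1, c2 <- bcomul c) \tsum_(c21, c22 <- bcomul c2) F c1 c21 c22 =
  \tsum_(c1, c2 <- bcomul c) \tsum_(c11, c12 <- bcomul c1)
    F ((baut B)⁻¹ c11) c12 (baut B c2).
Proof.
move=> [h1 h2].
have hL : bilin (fun (a : B) (u : tensor B B) => tsum (F ((baut B)⁻¹ a)) u).
  split=> [u|a]; last exact: tsum_linear.
  by apply: lin_tsum_f => b d x y z; rewrite linearP; apply: h2.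
have := congr1 (tsum (fun a u => tsum (F ((baut B)⁻¹ a)) u))
  (hcoalg_coassoc (bcoalgP B) c).
rewrite !tsum_tsum // => e; etransitivity; first (etransitivity; last exact: e).
  by apply: eq_tsum => a b; rewrite tsum_pure // autK.
apply: eq_tsum => a b; rewrite tsum_tsum //; apply: eq_tsum => x y.
by rewrite !tsum_pure.
Qed.

End Comul.

Section Coaction.
Variables (M : homComodule B) (P : lmodType k).

Lemma sw_rho_aut (F : B -> M -> P) m : bilin F ->
  tsum F (mrho (maut M m)) = \tsum_(c, x <- mrho m) F (baut B c) (maut M x).
Proof.
move=> h; rewrite (hcomod_aut (mcomodP M)) tsum_tsum //.
by apply: eq_tsum => a b; rewrite tsum_pure.
Qed.

Lemma sw_rho_auti (F : B -> M -> P) m : bilin F ->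
  tsum F (mrho ((maut M)⁻¹ m)) =
  \tsum_(c, x <- mrho m) F ((baut B)⁻¹ c) ((maut M)⁻¹ x).
Proof.
move=> [h1 h2]; rewrite -[in RHS](@autVK _ _ (maut M) m) sw_rho_aut.
  by apply: eq_tsum => a b; rewrite !autK.
by split=> [b|a] x u v /=; rewrite linearP; [apply: h1 | apply: h2].
Qed.

Lemma sw_rho_coassoc (F : B -> B -> M -> P) m : trilin F ->
  \tsum_(c, x <- mrho m) \tsum_(d, y <- mrho x) F c d y =
  \tsum_(c, x <- mrho m) \tsum_(c1, c2 <- bcomul c)
    F ((baut B)⁻¹ c1) c2 (maut M x).
Proof.
move=> [h1 h2].
have hL : bilin (fun (a : B) (u : tensor B M) => tsum (F ((baut B)⁻¹ a)) u).
  split=> [u|a]; last exact: tsum_linear.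
  by apply: lin_tsum_f => b d x y z; rewrite linearP; apply: h2.
have := congr1 (tsum (fun a u => tsum (F ((baut B)⁻¹ a)) u))
  (hcomod_coassoc (mcomodP M) m).
rewrite !tsum_tsum // => e; etransitivity; first (etransitivity; last exact: e).
  by apply: eq_tsum => a b; rewrite tsum_pure // autK.
apply: eq_tsum => a b; rewrite tsum_tsum //; apply: eq_tsum => x y.
by rewrite !tsum_pure.
Qed.

End Coaction.

Lemma sw_hom (M N : homComodule B) (f : comodHom M N) (P : lmodType k)
  (F : B -> N -> P) m : bilin F ->
  tsum F (mrho (f m)) = \tsum_(c, x <- mrho m) F c (f x).
Proof.
move=> h; rewrite chom_colinear tsum_tsum //.
by apply: eq_tsum => a b; rewrite tsum_pure.
Qed.

End Sweedler.

Section ComodTensor.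
Variables (k : fieldType) (B : homBialgebra k) (M N : homComodule B).
Local Notation beta := (baut B).

Lemma trho_linear : linear (fun t : tensor M N =>
  \tsum_(m, n <- t) \tsum_(a, x <- mrho m) \tsum_(b, y <- mrho n)
     beta⁻¹ (beta⁻¹ (bmul a b)) ⊗ (x ⊗ y)).
Proof. by lin. Qed.

Definition trho : {linear tensor M N -> tensor B (tensor M N)} := mklin trho_linear.

Arguments trho : simpl never.

Lemma trhoE m n : trho (m ⊗ n) =
  \tsum_(a, x <- mrho m) \tsum_(b, y <- mrho n) beta⁻¹ (beta⁻¹ (bmul a b)) ⊗ (x ⊗ y).
Proof. by rewrite /trho /= tsum_pure //; lin. Qed.

Lemma sw_trho (P : lmodType k) (F : B -> tensor M N -> P) m n : bilin F ->
  tsum F (trho (m ⊗ n)) =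
  \tsum_(a, x <- mrho m) \tsum_(b, y <- mrho n)
    F (beta⁻¹ (beta⁻¹ (bmul a b))) (x ⊗ y).
Proof.
move=> h; rewrite trhoE tsum_tsum //; apply: eq_tsum => a x.
rewrite tsum_tsum //; apply: eq_tsum => b y.
by rewrite tsum_pure.
Qed.

Lemma trho_comod :
  is_homComodule (@bcomul _ B) (@bcounit _ B) beta trho (taut (maut M) (maut N)).
Proof.
split.
- tens_ext=> m n.
  rewrite tmapE trhoE sw_trho; last by lin.
  rewrite sw_rho_aut; last by lin.
  apply: eq_tsum => a x; rewrite sw_rho_aut; last by lin.
  apply: eq_tsum => b y.
  by rewrite tmapE -(halg_autM (balgP B)) !autVK !autK.
- tens_ext=> m n.
  rewrite sw_trho; last by lin.
  rewrite tmapE -!(hcomod_counit (mcomodP _)).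
  rewrite (@lin_tsum _ _ _ _ _ (tpure^~ _)); last by lin.
  apply: eq_tsum => a x.
  rewrite (@lin_tsum _ _ _ _ _ (tpure _)); last by lin.
  apply: eq_tsum => b y.
  by rewrite !bcounit_auti bcounitM tpureZl tpureZr scalerA.
- tens_ext=> m n.
  rewrite sw_trho; last by lin.
  rewrite sw_trho; last by lin.
  transitivity (\tsum_(a, x <- mrho m) \tsum_(c, z <- mrho x)
    \tsum_(b, y <- mrho n) \tsum_(d, w <- mrho y)
      beta⁻¹ (bmul a b) ⊗ (beta⁻¹ (beta⁻¹ (bmul c d)) ⊗ (z ⊗ w))).
    apply: eq_tsum => a x; rewrite exchange_tsum.
    apply: eq_tsum => b y; rewrite trhoE autVK.
    rewrite (@lin_tsum _ _ _ _ _ (tpure _)); last by lin.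
    by apply: eq_tsum => c z; rewrite (@lin_tsum _ _ _ _ _ (tpure _)) //; lin.
  rewrite sw_rho_coassoc; last by split; lin.
  apply: eq_tsum => a x.
  transitivity (\tsum_(a1, a2 <- bcomul a) \tsum_(b, y <- mrho n)
    \tsum_(b1, b2 <- bcomul b) beta⁻¹ (bmul (beta⁻¹ a1) (beta⁻¹ b1)) ⊗
       (beta⁻¹ (beta⁻¹ (bmul a2 b2)) ⊗ (maut M x ⊗ maut N y))).
    by apply: eq_tsum => a1 a2; rewrite sw_rho_coassoc //; split; lin.
  rewrite exchange_tsum; apply: eq_tsum => b y.
  rewrite !sw_comul_auti; try by lin.
  rewrite sw_comul_mul; last by lin.
  by apply: eq_tsum => a1 a2; apply: eq_tsum => b1 b2; rewrite tmapE -bmul_auti.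
Qed.

Definition comodTens : homComodule B := HomComodule trho_comod.

Lemma sw_mrho_tens (P : lmodType k) (F : B -> comodTens -> P) (m : M) (n : N) :
  bilin F ->
  tsum F (mrho (m ⊗ n : comodTens)) =
  \tsum_(a, x <- mrho m) \tsum_(b, y <- mrho n)
    F (beta⁻¹ (beta⁻¹ (bmul a b))) (x ⊗ y).
Proof. exact: sw_trho. Qed.
End ComodTensor.

Arguments comodTens {k B} M N.

Section ComodCat.
Variables (k : fieldType) (B : homBialgebra k).
Local Notation beta := (baut B).
Implicit Types M N P Q : homComodule B.

Lemma eq_comodHom M N (f g : comodHom M N) : (forall m, f m = g m) -> f = g.
Proof.
case: f g => [f pf qf] [g pg qg] /= /eq_linfun e; subst g.
by rewrite (Prop_irrelevance pf pg) (Prop_irrelevance qf qg).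
Qed.

Lemma urho_linear : linear (fun x : k^o => bone B ⊗ x).
Proof. by lin. Qed.
Definition urho : {linear k^o -> tensor B k^o} := mklin urho_linear.

Lemma urho_comod :
  is_homComodule (@bcomul _ B) (@bcounit _ B) beta urho (idaut k^o).
Proof.
have h1 := halg_aut1 (balgP B).
split=> x /=.
- by rewrite tsum_pure ?h1 //; lin.
- by rewrite tsum_pure ?bcounit1 ?scale1r //; lin.
- rewrite !tsum_pure; try by lin.
  by rewrite bcomul1 tsum_pure ?h1 //; lin.
Qed.

Definition comodUnit : homComodule B := HomComodule urho_comod.

Lemma comodId_colinear M (m : M) :
  mrho (idfun m) = \tsum_(b, x <- mrho m) b ⊗ idfun x.
Proof. by rewrite [RHS]tsum_id. Qed.
Definition comodId M : comodHom M M :=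
  @ComodHom _ _ M M idfun (@comodId_colinear M) (fun _ => erefl).

Lemma comodComp_colinear M N P (g : comodHom N P) (f : comodHom M N) m :
  mrho ((g \o f) m) = \tsum_(b, x <- mrho m) b ⊗ (g \o f) x.
Proof. by rewrite /= chom_colinear sw_hom //; lin. Qed.
Lemma comodComp_aut M N P (g : comodHom N P) (f : comodHom M N) m :
  (g \o f) (maut M m) = maut P ((g \o f) m).
Proof. by rewrite /= !chom_aut. Qed.
Definition comodComp M N P (g : comodHom N P) (f : comodHom M N) : comodHom M P :=
  ComodHom (comodComp_colinear g f) (comodComp_aut g f).

Lemma comodTensHom_colinear M M' N N' (f : comodHom M M') (g : comodHom N N') :
  forall t : tensor M N,
  trho M' N' (tmap f g t) = \tsum_(b, x <- trho M N t) b ⊗ tmap f g x.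
Proof.
tens_ext=> m n; rewrite tmapE trhoE sw_trho; last by lin.
rewrite sw_hom; last by lin.
apply: eq_tsum => a x; rewrite sw_hom; last by lin.
by apply: eq_tsum => b y; rewrite tmapE.
Qed.
Lemma comodTensHom_aut M M' N N' (f : comodHom M M') (g : comodHom N N') :
  forall t : tensor M N,
  tmap f g (taut (maut M) (maut N) t) = taut (maut M') (maut N') (tmap f g t).
Proof. by tens_ext=> m n; rewrite !(tmapE, tautE) !chom_aut. Qed.
Definition comodTensHom M M' N N' (f : comodHom M M') (g : comodHom N N') :
    comodHom (comodTens M N) (comodTens M' N') :=
  @ComodHom _ _ (comodTens M N) (comodTens M' N') (tmap f g)
    (comodTensHom_colinear f g) (comodTensHom_aut f g).

Section Assoc.
Variables M N P : homComodule B.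

Lemma tassoc_linear : linear (fun x : tensor (tensor M N) P =>
  \tsum_(t, p <- x) \tsum_(m, n <- t) (maut M)⁻¹ m ⊗ (n ⊗ maut P p)).
Proof. by lin. Qed.
Definition tassoc : {linear tensor (tensor M N) P -> tensor M (tensor N P)} :=
  mklin tassoc_linear.
Lemma tassocE m n p : tassoc (m ⊗ n ⊗ p) = (maut M)⁻¹ m ⊗ (n ⊗ maut P p).
Proof. by rewrite /= !tsum_pure //; lin. Qed.
Arguments tassoc : simpl never.

Lemma tassoci_linear : linear (fun x : tensor M (tensor N P) =>
  \tsum_(m, t <- x) \tsum_(n, p <- t) maut M m ⊗ n ⊗ (maut P)⁻¹ p).
Proof. by lin. Qed.
Definition tassoci : {linear tensor M (tensor N P) -> tensor (tensor M N) P} :=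
  mklin tassoci_linear.
Lemma tassociE m n p : tassoci (m ⊗ (n ⊗ p)) = maut M m ⊗ n ⊗ (maut P)⁻¹ p.
Proof. by rewrite /= !tsum_pure //; lin. Qed.
Arguments tassoci : simpl never.

Lemma tassocK : cancel tassoc tassoci.
Proof.
rewrite /cancel; tens_ext=> t p; move: t; tens_ext=> m n.
by rewrite tassocE tassociE autVK autK.
Qed.

Lemma tassociK : cancel tassoci tassoc.
Proof.
rewrite /cancel; tens_ext=> m t; move: t; tens_ext=> n p.
by rewrite tassociE tassocE autVK autK.
Qed.

Lemma comodAssoc_colinear : forall x : tensor (tensor M N) P,
  trho M (comodTens N P) (tassoc x) =
  \tsum_(b, y <- trho (comodTens M N) P x) b ⊗ tassoc y.
Proof.
tens_ext=> t p; move: t; tens_ext=> m n.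
rewrite tassocE trhoE.
rewrite sw_rho_auti; last by lin.
rewrite (@sw_trho _ _ (comodTens M N) P); last by lin.
rewrite (@sw_mrho_tens _ _ M N); last by lin.
apply: eq_tsum => a x; rewrite (@sw_mrho_tens _ _ N P); last by lin.
apply: eq_tsum => b y; rewrite sw_rho_aut; last by lin.
apply: eq_tsum => c z; rewrite tassocE; congr (_ ⊗ _).
congr (_ _); congr (_ _); rewrite !bmul_auti autK.
have := halg_assoc (balgP B) (beta⁻¹ (beta⁻¹ a)) (beta⁻¹ (beta⁻¹ b)) (beta⁻¹ c).
by rewrite !autVK.
Qed.

Lemma comodAssoc_aut : forall x : tensor (tensor M N) P,
  tassoc (taut (taut (maut M) (maut N)) (maut P) x) =
  taut (maut M) (taut (maut N) (maut P)) (tassoc x).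
Proof.
tens_ext=> t p; move: t; tens_ext=> m n.
by rewrite !tautE !tassocE !tautE autK autVK.
Qed.

Definition comodAssoc :
    comodHom (comodTens (comodTens M N) P) (comodTens M (comodTens N P)) :=
  @ComodHom _ _ (comodTens (comodTens M N) P) (comodTens M (comodTens N P))
    tassoc comodAssoc_colinear comodAssoc_aut.

End Assoc.

Lemma comodHom_inv_colinear M N (f : comodHom M N) (g : {linear N -> M}) :
  cancel f g -> cancel g f -> forall n,
  mrho (g n) = \tsum_(b, x <- mrho n) b ⊗ g x.
Proof.
move=> fK gK n; rewrite -[in RHS](gK n) sw_hom; last by lin.
by rewrite -[LHS]tsum_id; apply: eq_tsum => b x; rewrite fK.
Qed.
Lemma comodHom_inv_aut M N (f : comodHom M N) (g : {linear N -> M}) :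
  cancel f g -> cancel g f -> forall n, g (maut N n) = maut M (g n).
Proof. by move=> fK gK n; rewrite -{1}(gK n) -chom_aut fK. Qed.
Definition comodHom_inv M N (f : comodHom M N) (g : {linear N -> M})
    (fK : cancel f g) (gK : cancel g f) : comodHom N M :=
  ComodHom (comodHom_inv_colinear fK gK) (comodHom_inv_aut fK gK).

Definition comodAssocI M N P :
    comodHom (comodTens M (comodTens N P)) (comodTens (comodTens M N) P) :=
  @comodHom_inv _ _ (comodAssoc M N P) (tassoci M N P)
    (@tassocK M N P) (@tassociK M N P).

Section Unit.
Variable M : homComodule B.

Lemma tlunit_linear : linear (fun t : tensor k^o M =>
  tsum (fun (a : k^o) (m : M) => a *: (maut M)⁻¹ m) t).
Proof. by lin. Qed.
Definition tlunit : {linear tensor k^o M -> M} := mklin tlunit_linear.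
Lemma tlunitE (a : k^o) m : tlunit (a ⊗ m) = a *: (maut M)⁻¹ m.
Proof. by rewrite /= !tsum_pure //; lin. Qed.
Arguments tlunit : simpl never.

Lemma trunit_linear : linear (fun t : tensor M k^o =>
  tsum (fun (m : M) (a : k^o) => a *: (maut M)⁻¹ m) t).
Proof. by lin. Qed.
Definition trunit : {linear tensor M k^o -> M} := mklin trunit_linear.
Lemma trunitE (a : k^o) m : trunit (m ⊗ a) = a *: (maut M)⁻¹ m.
Proof. by rewrite /= !tsum_pure //; lin. Qed.
Arguments trunit : simpl never.

Lemma tluniti_linear : linear (fun m => (1 : k^o) ⊗ maut M m).
Proof. by lin. Qed.
Lemma truniti_linear : linear (fun m => maut M m ⊗ (1 : k^o)).
Proof. by lin. Qed.

Lemma tlunitK : cancel tlunit (mklin tluniti_linear).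
Proof.
rewrite /cancel; tens_ext=> a m.
by rewrite tlunitE mklinE linearZZ autVK tpureZr -tpureZl [_ *: _]mulr1.
Qed.
Lemma tlunitiK : cancel (mklin tluniti_linear) tlunit.
Proof. by move=> m; rewrite mklinE tlunitE scale1r autK. Qed.
Lemma trunitK : cancel trunit (mklin truniti_linear).
Proof.
rewrite /cancel; tens_ext=> m a.
by rewrite trunitE mklinE linearZZ autVK tpureZl -tpureZr [_ *: _]mulr1.
Qed.
Lemma trunitiK : cancel (mklin truniti_linear) trunit.
Proof. by move=> m; rewrite mklinE trunitE scale1r autK. Qed.

Lemma comodLunit_colinear : forall t : tensor k^o M,
  mrho (tlunit t) = \tsum_(b, x <- trho comodUnit M t) b ⊗ tlunit x.
Proof.
tens_ext=> a m; rewrite tlunitE linearZZ (@sw_trho _ _ comodUnit M); last by lin.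
rewrite tsum_pure; last by lin.
rewrite -[mrho (_⁻¹ m)]tsum_id sw_rho_auti; last by lin.
rewrite tsumZ.
apply: eq_tsum => b x; rewrite tlunitE tpureZr; congr (_ *: (_ ⊗ _)).
by rewrite (halg_mul1r (balgP B)) autK.
Qed.
Lemma comodLunit_aut : forall t : tensor k^o M,
  tlunit (taut (idaut k^o) (maut M) t) = maut M (tlunit t).
Proof. by tens_ext=> a m; rewrite tautE !tlunitE linearZZ idautE autK autVK. Qed.
Definition comodLunit : comodHom (comodTens comodUnit M) M :=
  @ComodHom _ _ (comodTens comodUnit M) M tlunit
    comodLunit_colinear comodLunit_aut.

Lemma comodRunit_colinear : forall t : tensor M k^o,
  mrho (trunit t) = \tsum_(b, x <- trho M comodUnit t) b ⊗ trunit x.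
Proof.
tens_ext=> m a; rewrite trunitE linearZZ (@sw_trho _ _ M comodUnit); last by lin.
rewrite -[mrho (_⁻¹ m)]tsum_id sw_rho_auti; last by lin.
rewrite tsumZ.
apply: eq_tsum => b x.
rewrite tsum_pure; last by lin.
rewrite trunitE tpureZr; congr (_ *: (_ ⊗ _)).
by rewrite (halg_mulr1 (balgP B)) autK.
Qed.
Lemma comodRunit_aut : forall t : tensor M k^o,
  trunit (taut (maut M) (idaut k^o) t) = maut M (trunit t).
Proof. by tens_ext=> m a; rewrite tautE !trunitE linearZZ idautE autK autVK. Qed.
Definition comodRunit : comodHom (comodTens M comodUnit) M :=
  @ComodHom _ _ (comodTens M comodUnit) M trunit
    comodRunit_colinear comodRunit_aut.

Definition comodLunitI : comodHom M (comodTens comodUnit M) :=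
  @comodHom_inv _ _ comodLunit (mklin tluniti_linear) tlunitK tlunitiK.
Definition comodRunitI : comodHom M (comodTens M comodUnit) :=
  @comodHom_inv _ _ comodRunit (mklin truniti_linear) trunitK trunitiK.

End Unit.
End ComodCat.

Section LongTensor.
Variables (k : fieldType) (H B : homBialgebra k).
Local Notation alpha := (baut H).
Local Notation beta := (baut B).

Lemma lact_aut (M : homLong H B) h m :
  maut M (lact h m) = lact (alpha h) (maut M m).
Proof. exact: hmod_aut (hlong_mod (longP M)) _ _. Qed.
Lemma lact_assoc (M : homLong H B) g h (m : M) :
  lact (alpha g) (lact h m) = lact (bmul g h) (maut M m).
Proof. exact: hmod_assoc (hlong_mod (longP M)) _ _ _. Qed.
Lemma lact_auti (M : homLong H B) h m :
  (maut M)⁻¹ (lact h m) = lact (alpha⁻¹ h) ((maut M)⁻¹ m).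
Proof. by apply: (can_inj (@autK _ _ (maut M))); rewrite lact_aut !autVK. Qed.

Lemma sw_lact (M : homLong H B) (P : lmodType k) (F : B -> M -> P) h m : bilin F ->
  tsum F (mrho (lact h m)) = \tsum_(b, x <- mrho m) F (beta b) (lact (alpha h) x).
Proof.
move=> hF; rewrite (hlong_compat (longP M)) tsum_tsum //.
by apply: eq_tsum => a b; rewrite tsum_pure.
Qed.

Section Tens.
Variables M N : homLong H B.

Lemma tact_bilin : bilin (fun (h : H) (t : tensor M N) =>
  \tsum_(m, n <- t) \tsum_(h1, h2 <- bcomul h) lact h1 m ⊗ lact h2 n).
Proof. by lin. Qed.
Definition tact : {bilinear H -> tensor M N -> tensor M N} := mkbil tact_bilin.
Lemma tactE h m n :
  tact h (m ⊗ n) = \tsum_(h1, h2 <- bcomul h) lact h1 m ⊗ lact h2 n.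
Proof. by rewrite /= tsum_pure //; lin. Qed.
Arguments tact : simpl never.

Lemma tact_long : @is_homLong _ H B (comodTens M N) tact.
Proof.
split; first split.
- move=> h; rewrite [maut _]/(taut (maut M) (maut N)); tens_ext=> m n.
  rewrite tautE !tactE lin_tsum; last by lin.
  rewrite sw_comul_aut; last by lin.
  by apply: eq_tsum => h1 h2; rewrite tautE !lact_aut.
- move=> g h; rewrite [maut _]/(taut (maut M) (maut N)); tens_ext=> m n.
  rewrite tautE !tactE lin_tsum; last by lin.
  rewrite sw_comul_mul; last by lin.
  rewrite exchange_tsum; apply: eq_tsum => h1 h2.
  rewrite tactE sw_comul_aut; last by lin.
  by apply: eq_tsum => g1 g2; rewrite !lact_assoc.
- rewrite [maut _]/(taut (maut M) (maut N)); tens_ext=> m n.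
  rewrite tautE tactE bcomul1 tsum_pure; last by lin.
  by rewrite (hmod_act1 (hlong_mod (longP M))) (hmod_act1 (hlong_mod (longP N))).
- move=> h; rewrite [@mrho _ _ _]/(trho M N); tens_ext=> m n.
  rewrite tactE lin_tsum; last by lin.
  rewrite sw_trho; last by lin.
  transitivity (\tsum_(h1, h2 <- bcomul h)
    \tsum_(a, x <- mrho m) \tsum_(b, y <- mrho n)
      beta⁻¹ (bmul a b) ⊗ (lact (alpha h1) x ⊗ lact (alpha h2) y)).
    apply: eq_tsum => h1 h2; rewrite trhoE sw_lact; last by lin.
    apply: eq_tsum => a x; rewrite sw_lact; last by lin.
    apply: eq_tsum => b y.
    by rewrite -(halg_autM (balgP B)) autK.
  rewrite exchange_tsum; apply: eq_tsum => a x.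
  rewrite exchange_tsum; apply: eq_tsum => b y.
  rewrite autVK tactE sw_comul_aut; last by lin.
  by rewrite lin_tsum //; lin.
Qed.

Definition longTens : homLong H B := HomLong tact_long.
End Tens.

Lemma uact_bilin : bilin (fun (h : H) (x : k^o) => bcounit h *: x).
Proof. by lin. Qed.
Definition uact : {bilinear H -> k^o -> k^o} := mkbil uact_bilin.
Lemma uactE h x : uact h x = bcounit h *: x. Proof. by []. Qed.
Arguments uact : simpl never.

Lemma uact_long : @is_homLong _ H B (comodUnit B) uact.
Proof.
split; first split.
- move=> h x; rewrite [maut _]/(idaut k^o) !idautE !uactE.
  by rewrite (hcoalg_counit_aut (bcoalgP H)).
- move=> g h x; rewrite [maut _]/(idaut k^o) !idautE !uactE.
  by rewrite (hcoalg_counit_aut (bcoalgP H)) bcounitM scalerA.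
- by move=> x; rewrite [maut _]/(idaut k^o) !idautE uactE bcounit1 scale1r.
- move=> h x; rewrite [@mrho _ _ _]/(urho B) !mklinE tsum_pure; last by lin.
  rewrite (halg_aut1 (balgP B)); congr (_ ⊗ _).
  by rewrite !uactE (hcoalg_counit_aut (bcoalgP H)).
Qed.

Definition longUnit : homLong H B := HomLong uact_long.

Lemma eq_longHom (M N : homLong H B) (f g : longHom M N) :
  lhom f = lhom g -> f = g.
Proof.
case: f g => [f pf] [g pg] /= e; subst g.
by rewrite (Prop_irrelevance pf pg).
Qed.

Definition longId (M : homLong H B) : longHom M M :=
  @LongHom _ _ _ M M (comodId M) (fun _ _ => erefl).

Lemma longComp_act (M N P : homLong H B) (g : longHom N P) (f : longHom M N) h m :
  comodComp g f (lact h m) = lact h (comodComp g f m).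
Proof. by rewrite /= !lhom_act. Qed.
Definition longComp (M N P : homLong H B) (g : longHom N P) (f : longHom M N) :
  longHom M P := LongHom (longComp_act g f).

Lemma longTensHom_act (M M' N N' : homLong H B) (f : longHom M M')
    (g : longHom N N') h : forall t : tensor M N,
  tmap f g (tact M N h t) = tact M' N' h (tmap f g t).
Proof.
tens_ext=> m n; rewrite tmapE !tactE lin_tsum; last by lin.
by apply: eq_tsum => h1 h2; rewrite tmapE !lhom_act.
Qed.
Definition longTensHom (M M' N N' : homLong H B) (f : longHom M M')
    (g : longHom N N') : longHom (longTens M N) (longTens M' N') :=
  @LongHom _ _ _ (longTens M N) (longTens M' N') (comodTensHom f g)
    (longTensHom_act f g).

Lemma longHom_inv_act (M N : homLong H B) (f : longHom M N) (g : comodHom N M) :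
  cancel f g -> cancel g f -> forall h n, g (lact h n) = lact h (g n).
Proof. by move=> fK gK h n; rewrite -{1}(gK n) -lhom_act fK. Qed.
Definition longHom_inv (M N : homLong H B) (f : longHom M N) (g : comodHom N M)
    (fK : cancel f g) (gK : cancel g f) : longHom N M :=
  LongHom (longHom_inv_act fK gK).

Lemma longAssoc_act (M N P : homLong H B) h : forall t : tensor (tensor M N) P,
  tassoc M N P (tact (longTens M N) P h t) =
  tact M (longTens N P) h (tassoc M N P t).
Proof.
tens_ext=> t p; move: t; tens_ext=> m n.
rewrite (@tactE (longTens M N) P) tassocE (@tactE M (longTens N P)).
transitivity (\tsum_(h1, h2 <- bcomul h) \tsum_(h11, h12 <- bcomul h1)
  lact (alpha⁻¹ h11) ((maut M)⁻¹ m) ⊗ (lact h12 n ⊗ lact (alpha h2) (maut P p))).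
  rewrite lin_tsum; last by lin.
  apply: eq_tsum => h1 h2; rewrite [lact h1 _]tactE.
  rewrite (@lin_tsum _ _ _ _ _ (tpure^~ _)); last by lin.
  rewrite lin_tsum; last by lin.
  by apply: eq_tsum => h11 h12; rewrite tassocE lact_aut lact_auti.
symmetry; rewrite -(sw_comul_coassoc (F := fun a b c =>
  lact a ((maut M)⁻¹ m) ⊗ (lact b n ⊗ lact c (maut P p)))); last by split; lin.
apply: eq_tsum => h1 h2; rewrite [lact h2 _]tactE.
by rewrite (@lin_tsum _ _ _ _ _ (tpure _)) //; lin.
Qed.
Definition longAssoc (M N P : homLong H B) :
    longHom (longTens (longTens M N) P) (longTens M (longTens N P)) :=
  @LongHom _ _ _ (longTens (longTens M N) P) (longTens M (longTens N P))
    (comodAssoc M N P) (@longAssoc_act M N P).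
Definition longAssocI (M N P : homLong H B) :
    longHom (longTens M (longTens N P)) (longTens (longTens M N) P) :=
  @longHom_inv _ _ (longAssoc M N P) (comodAssocI M N P)
    (@tassocK _ _ M N P) (@tassociK _ _ M N P).

Lemma longLunit_act (M : homLong H B) h : forall t : tensor k^o M,
  tlunit M (tact longUnit M h t) = lact h (tlunit M t).
Proof.
tens_ext=> a m; rewrite (@tactE longUnit M) tlunitE linearZr_LR.
rewrite lin_tsum; last by lin.
transitivity (a *: (maut M)⁻¹ (lact (alpha h) m)); last first.
  by rewrite lact_auti autK.
rewrite -[alpha h](hcoalg_counitl (bcoalgP H)).
rewrite (@lin_tsum _ _ _ _ _ (fun x => (maut M)⁻¹ (lact x m))); last by lin.
rewrite (@tsumZ _ _ _ M); apply: eq_tsum => h1 h2.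
by rewrite tlunitE linearZl_LR linearZZ scalerA [lact _ _]uactE mulrC.
Qed.
Definition longLunit (M : homLong H B) : longHom (longTens longUnit M) M :=
  @LongHom _ _ _ (longTens longUnit M) M (comodLunit M) (@longLunit_act M).

Lemma longRunit_act (M : homLong H B) h : forall t : tensor M k^o,
  trunit M (tact M longUnit h t) = lact h (trunit M t).
Proof.
tens_ext=> m a; rewrite (@tactE M longUnit) trunitE linearZr_LR.
rewrite lin_tsum; last by lin.
transitivity (a *: (maut M)⁻¹ (lact (alpha h) m)); last first.
  by rewrite lact_auti autK.
rewrite -[alpha h](hcoalg_counitr (bcoalgP H)).
rewrite (@lin_tsum _ _ _ _ _ (fun x => (maut M)⁻¹ (lact x m))); last by lin.
rewrite (@tsumZ _ _ _ M); apply: eq_tsum => h1 h2.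
by rewrite trunitE linearZl_LR linearZZ scalerA [lact _ _]uactE mulrC.
Qed.
Definition longRunit (M : homLong H B) : longHom (longTens M longUnit) M :=
  @LongHom _ _ _ (longTens M longUnit) M (comodRunit M) (@longRunit_act M).

Definition longLunitI (M : homLong H B) : longHom M (longTens longUnit M) :=
  @longHom_inv _ _ (longLunit M) (comodLunitI M)
    (@tlunitK _ _ M) (@tlunitiK _ _ M).
Definition longRunitI (M : homLong H B) : longHom M (longTens M longUnit) :=
  @longHom_inv _ _ (longRunit M) (comodRunitI M)
    (@trunitK _ _ M) (@trunitiK _ _ M).

End LongTensor.

Declare Scope cat_scope.
Local Open Scope cat_scope.

Record category := Category {
  Ob :> Type;
  mor : Ob -> Ob -> Type;
  idm : forall X, mor X X;
  compm : forall X Y Z, mor Y Z -> mor X Y -> mor X Z;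
  compmA : forall W X Y Z (h : mor Y Z) (g : mor X Y) (f : mor W X),
    compm h (compm g f) = compm (compm h g) f;
  compm1 : forall X Y (f : mor X Y), compm f (idm X) = f;
  comp1m : forall X Y (f : mor X Y), compm (idm Y) f = f
}.
Arguments mor {_}.
Arguments idm {_}.
Notation "g ∘ f" := (compm g f) (at level 40, left associativity) : cat_scope.

Definition is_iso (C : category) (X Y : C) (f : mor X Y) : Prop :=
  exists g : mor Y X, g ∘ f = idm X /\ f ∘ g = idm Y.

Record functor (C D : category) := Functor {
  fobj :> C -> D;
  fmap : forall X Y, mor X Y -> mor (fobj X) (fobj Y);
  fmap_id : forall X, fmap (idm X) = idm (fobj X);
  fmap_comp : forall X Y Z (g : mor Y Z) (f : mor X Y),
    fmap (g ∘ f) = fmap g ∘ fmap f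
}.
Arguments fmap {C D} F {X Y} : rename.

Definition faithful (C D : category) (F : functor C D) : Prop :=
  forall X Y, injective (@fmap _ _ F X Y).

Reserved Notation "X ⊠ Y" (at level 38, left associativity).
Reserved Notation "f ⊠m g" (at level 38, left associativity).

Record monoidalCategory := MonoidalCategory {
  mcat :> category;
  mtens : mcat -> mcat -> mcat where "X ⊠ Y" := (mtens X Y);
  mtensm : forall X X' Y Y', mor X X' -> mor Y Y' -> mor (X ⊠ Y) (X' ⊠ Y')
    where "f ⊠m g" := (mtensm f g);
  munit : mcat;
  massoc : forall X Y Z, mor (X ⊠ Y ⊠ Z) (X ⊠ (Y ⊠ Z));
  massocI : forall X Y Z, mor (X ⊠ (Y ⊠ Z)) (X ⊠ Y ⊠ Z);
  mlunit : forall X, mor (munit ⊠ X) X;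
  mrunit : forall X, mor (X ⊠ munit) X;
  mtensm_id : forall X Y, idm X ⊠m idm Y = idm (X ⊠ Y);
  mtensm_comp : forall X X' X'' Y Y' Y'' (f' : mor X' X'') (f : mor X X')
      (g' : mor Y' Y'') (g : mor Y Y'),
    (f' ∘ f) ⊠m (g' ∘ g) = (f' ⊠m g') ∘ (f ⊠m g);
  massocK : forall X Y Z, massocI X Y Z ∘ massoc X Y Z = idm _;
  massocIK : forall X Y Z, massoc X Y Z ∘ massocI X Y Z = idm _;
  mlunit_iso : forall X, is_iso (mlunit X);
  mrunit_iso : forall X, is_iso (mrunit X);
  massoc_nat : forall X X' Y Y' Z Z' (f : mor X X') (g : mor Y Y') (h : mor Z Z'),
    massoc X' Y' Z' ∘ (f ⊠m g ⊠m h) = (f ⊠m (g ⊠m h)) ∘ massoc X Y Z;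
  mlunit_nat : forall X Y (f : mor X Y),
    mlunit Y ∘ (idm munit ⊠m f) = f ∘ mlunit X;
  mrunit_nat : forall X Y (f : mor X Y),
    mrunit Y ∘ (f ⊠m idm munit) = f ∘ mrunit X;
  mpentagon : forall W X Y Z,
    massoc W X (Y ⊠ Z) ∘ massoc (W ⊠ X) Y Z =
    (idm W ⊠m massoc X Y Z) ∘ massoc W (X ⊠ Y) Z ∘ (massoc W X Y ⊠m idm Z);
  mtriangle : forall X Y,
    (idm X ⊠m mlunit Y) ∘ massoc X munit Y = mrunit X ⊠m idm Y
}.
Arguments mtens {_}.
Arguments mtensm {_ _ _ _ _}.
Arguments munit _.
Arguments massoc {_}.
Arguments massocI {_}.
Arguments mlunit {_}.
Arguments mrunit {_}.
Notation "X ⊠ Y" := (mtens X Y) : cat_scope.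
Notation "f ⊠m g" := (mtensm f g) : cat_scope.

(* Strong monoidal functors: the comparison maps phi, phi0 are isomorphisms. *)
Record is_monoidal_functor (C D : monoidalCategory) (F : functor C D)
    (phi : forall X Y, mor (F X ⊠ F Y) (F (X ⊠ Y)))
    (phi0 : mor (munit D) (F (munit C))) : Prop := IsMonoidalFunctor {
  mfun_iso : forall X Y, is_iso (phi X Y);
  mfun_iso0 : is_iso phi0;
  mfun_nat : forall X X' Y Y' (f : mor X X') (g : mor Y Y'),
    phi X' Y' ∘ (fmap F f ⊠m fmap F g) = fmap F (f ⊠m g) ∘ phi X Y;
  mfun_assoc : forall X Y Z,
    fmap F (massoc X Y Z) ∘ phi (X ⊠ Y) Z ∘ (phi X Y ⊠m idm (F Z)) =
    phi X (Y ⊠ Z) ∘ (idm (F X) ⊠m phi Y Z) ∘ massoc (F X) (F Y) (F Z);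
  mfun_lunit : forall X,
    fmap F (mlunit X) ∘ phi (munit C) X ∘ (phi0 ⊠m idm (F X)) = mlunit (F X);
  mfun_runit : forall X,
    fmap F (mrunit X) ∘ phi X (munit C) ∘ (idm (F X) ⊠m phi0) = mrunit (F X)
}.
Arguments is_monoidal_functor {C D} F phi phi0.

Record braiding (C : monoidalCategory) := Braiding {
  braid :> forall X Y : C, mor (X ⊠ Y) (Y ⊠ X);
  braid_iso : forall X Y, is_iso (braid X Y);
  braid_nat : forall X X' Y Y' (f : mor X X') (g : mor Y Y'),
    braid X' Y' ∘ (f ⊠m g) = (g ⊠m f) ∘ braid X Y;
  braid_hexagon1 : forall X Y Z,
    massoc Y Z X ∘ braid X (Y ⊠ Z) ∘ massoc X Y Z =
    (idm Y ⊠m braid X Z) ∘ massoc Y X Z ∘ (braid X Y ⊠m idm Z);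
  braid_hexagon2 : forall X Y Z,
    massocI Z X Y ∘ braid (X ⊠ Y) Z ∘ massocI X Y Z =
    (braid X Z ⊠m idm Y) ∘ massocI X Z Y ∘ (idm X ⊠m braid Y Z)
}.

Definition symmetric_braiding (C : monoidalCategory) (c : braiding C) : Prop :=
  forall X Y, c Y X ∘ c X Y = idm (X ⊠ Y).

Section ComodMonoidal.
Variables (k : fieldType) (B : homBialgebra k).

Lemma comodCompA (W X Y Z : homComodule B) (h : comodHom Y Z) (g : comodHom X Y)
  (f : comodHom W X) : comodComp h (comodComp g f) = comodComp (comodComp h g) f.
Proof. exact: eq_comodHom. Qed.
Lemma comodComp1 (X Y : homComodule B) (f : comodHom X Y) :
  comodComp f (comodId X) = f.
Proof. exact: eq_comodHom. Qed.
Lemma comod1Comp (X Y : homComodule B) (f : comodHom X Y) :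
  comodComp (comodId Y) f = f.
Proof. exact: eq_comodHom. Qed.

Definition comodCat : category :=
  @Category (homComodule B) (@comodHom _ B) (@comodId _ B) (@comodComp _ B)
    comodCompA comodComp1 comod1Comp.

Lemma comodTensE (X X' Y Y' : homComodule B) (f : comodHom X X')
  (g : comodHom Y Y') x y : comodTensHom f g (x ⊗ y) = f x ⊗ g y.
Proof. exact: tmapE. Qed.
Lemma comodAssocE (X Y Z : homComodule B) x y z :
  comodAssoc X Y Z (x ⊗ y ⊗ z) = (maut X)⁻¹ x ⊗ (y ⊗ maut Z z).
Proof. exact: tassocE. Qed.
Lemma comodAssocIE (X Y Z : homComodule B) x y z :
  comodAssocI X Y Z (x ⊗ (y ⊗ z)) = maut X x ⊗ y ⊗ (maut Z)⁻¹ z.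
Proof. exact: tassociE. Qed.
Lemma comodLunitE (X : homComodule B) (a : k^o) x :
  comodLunit X (a ⊗ x) = a *: (maut X)⁻¹ x.
Proof. exact: tlunitE. Qed.
Lemma comodRunitE (X : homComodule B) (a : k^o) x :
  comodRunit X (x ⊗ a) = a *: (maut X)⁻¹ x.
Proof. exact: trunitE. Qed.
Lemma comodCompE (X Y Z : homComodule B) (g : comodHom Y Z) (f : comodHom X Y) x :
  comodComp g f x = g (f x).
Proof. by []. Qed.
Lemma comodIdE (X : homComodule B) x : comodId X x = x.
Proof. by []. Qed.

Lemma comodTens_id (X Y : homComodule B) :
  comodTensHom (comodId X) (comodId Y) = comodId (comodTens X Y).
Proof. by apply: eq_comodHom; tens_ext=> x y; rewrite comodTensE. Qed.
Lemma comodTens_comp (X X' X'' Y Y' Y'' : homComodule B)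
    (f' : comodHom X' X'') (f : comodHom X X')
    (g' : comodHom Y' Y'') (g : comodHom Y Y') :
  comodTensHom (comodComp f' f) (comodComp g' g) =
  comodComp (comodTensHom f' g') (comodTensHom f g).
Proof.
by apply: eq_comodHom; tens_ext=> x y; rewrite comodCompE !comodTensE.
Qed.
Lemma comodAssocK (X Y Z : homComodule B) :
  comodComp (comodAssocI X Y Z) (comodAssoc X Y Z) = comodId _.
Proof. by apply: eq_comodHom => x; apply: tassocK. Qed.
Lemma comodAssocIK (X Y Z : homComodule B) :
  comodComp (comodAssoc X Y Z) (comodAssocI X Y Z) = comodId _.
Proof. by apply: eq_comodHom => x; apply: tassociK. Qed.
Lemma comodLunit_iso (X : homComodule B) :
  @is_iso comodCat (comodTens (comodUnit B) X) X (comodLunit X).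
Proof.
exists (comodLunitI X); split; apply: eq_comodHom => x.
  exact: tlunitK.
exact: tlunitiK.
Qed.
Lemma comodRunit_iso (X : homComodule B) :
  @is_iso comodCat (comodTens X (comodUnit B)) X (comodRunit X).
Proof.
exists (comodRunitI X); split; apply: eq_comodHom => x.
  exact: trunitK.
exact: trunitiK.
Qed.
Lemma chom_auti (X Y : homComodule B) (f : comodHom X Y) x :
  f ((maut X)⁻¹ x) = (maut Y)⁻¹ (f x).
Proof. by apply: (can_inj (@autK _ _ (maut Y))); rewrite -chom_aut !autVK. Qed.
Lemma comodAssoc_nat (X X' Y Y' Z Z' : homComodule B)
    (f : comodHom X X') (g : comodHom Y Y') (h : comodHom Z Z') :
  comodComp (comodAssoc X' Y' Z') (comodTensHom (comodTensHom f g) h) =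
  comodComp (comodTensHom f (comodTensHom g h)) (comodAssoc X Y Z).
Proof.
apply: eq_comodHom; tens_ext=> t z; move: t; tens_ext=> x y.
rewrite !comodCompE (@comodTensE (comodTens X Y) (comodTens X' Y')) comodTensE.
rewrite !comodAssocE (@comodTensE X X' (comodTens Y Z)) comodTensE.
by rewrite chom_auti chom_aut.
Qed.
Lemma comodLunit_nat (X Y : homComodule B) (f : comodHom X Y) :
  comodComp (comodLunit Y) (comodTensHom (comodId (comodUnit B)) f) =
  comodComp f (comodLunit X).
Proof.
apply: eq_comodHom; tens_ext=> a x.
rewrite !comodCompE (@comodTensE (comodUnit B) (comodUnit B)) !comodLunitE.
by rewrite comodIdE [RHS]linearZZ chom_auti.
Qed.
Lemma comodRunit_nat (X Y : homComodule B) (f : comodHom X Y) :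
  comodComp (comodRunit Y) (comodTensHom f (comodId (comodUnit B))) =
  comodComp f (comodRunit X).
Proof.
apply: eq_comodHom; tens_ext=> x a.
rewrite !comodCompE (@comodTensE _ _ (comodUnit B) (comodUnit B)) !comodRunitE.
by rewrite comodIdE [RHS]linearZZ chom_auti.
Qed.
Lemma comodPentagon (W X Y Z : homComodule B) :
  comodComp (comodAssoc W X (comodTens Y Z)) (comodAssoc (comodTens W X) Y Z) =
  comodComp (comodComp (comodTensHom (comodId W) (comodAssoc X Y Z))
                       (comodAssoc W (comodTens X Y) Z))
            (comodTensHom (comodAssoc W X Y) (comodId Z)).
Proof.
apply: eq_comodHom; tens_ext=> t z; move: t; tens_ext=> t y; move: t.
tens_ext=> w x; rewrite !comodCompE.
rewrite (@comodAssocE (comodTens W X) Y Z).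
rewrite (@comodTensE _ _ Z Z) comodAssocE comodIdE.
rewrite (@comodAssocE W (comodTens X Y) Z) (@comodTensE W W) comodAssocE.
have -> : (maut (comodTens W X))⁻¹ (w ⊗ x) = (maut W)⁻¹ w ⊗ (maut X)⁻¹ x.
  exact: tmapE.
rewrite (@comodAssocE W X (comodTens Y Z)) comodIdE.
by rewrite [maut _ _]tautE.
Qed.
Lemma comodTriangle (X Y : homComodule B) :
  comodComp (comodTensHom (comodId X) (comodLunit Y))
            (comodAssoc X (comodUnit B) Y) =
  comodTensHom (comodRunit X) (comodId Y).
Proof.
apply: eq_comodHom; tens_ext=> t y; move: t; tens_ext=> x a.
rewrite !comodCompE (@comodAssocE X (comodUnit B) Y) (@comodTensE X X) comodLunitE.
rewrite (@comodTensE _ _ Y Y) comodRunitE !comodIdE autK.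
by rewrite tpureZl tpureZr.
Qed.

Definition comodMonoidal : monoidalCategory :=
  @MonoidalCategory comodCat (@comodTens _ B) (@comodTensHom _ B) (comodUnit B)
    (@comodAssoc _ B) (@comodAssocI _ B) (@comodLunit _ B) (@comodRunit _ B)
    comodTens_id comodTens_comp comodAssocK comodAssocIK
    comodLunit_iso comodRunit_iso comodAssoc_nat comodLunit_nat comodRunit_nat
    comodPentagon comodTriangle.

End ComodMonoidal.

Section LongMonoidal.
Variables (k : fieldType) (H B : homBialgebra k).

Definition longCat : category.
Proof.
refine (@Category (homLong H B) (@longHom _ H B) (@longId _ H B) (@longComp _ H B)
  _ _ _).
- by abstract (intros; apply: eq_longHom; exact: comodCompA).
- by abstract (intros; apply: eq_longHom; exact: comodComp1).
- by abstract (intros; apply: eq_longHom; exact: comod1Comp).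
Defined.

Lemma longLunit_iso (X : homLong H B) :
  @is_iso longCat (longTens (longUnit H B) X) X (longLunit X).
Proof.
exists (longLunitI X); split; apply: eq_longHom; apply: eq_comodHom => x.
  exact: tlunitK.
exact: tlunitiK.
Qed.
Lemma longRunit_iso (X : homLong H B) :
  @is_iso longCat (longTens X (longUnit H B)) X (longRunit X).
Proof.
exists (longRunitI X); split; apply: eq_longHom; apply: eq_comodHom => x.
  exact: trunitK.
exact: trunitiK.
Qed.

Definition longMonoidal : monoidalCategory.
Proof.
refine (@MonoidalCategory longCat (@longTens _ H B) (@longTensHom _ H B)
  (longUnit H B) (@longAssoc _ H B) (@longAssocI _ H B) (@longLunit _ H B)
  (@longRunit _ H B) _ _ _ _ longLunit_iso longRunit_iso _ _ _ _ _).
- by abstract (intros; apply: eq_longHom; exact: comodTens_id).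
- by abstract (intros; apply: eq_longHom; exact: comodTens_comp).
- by abstract (intros; apply: eq_longHom; exact: comodAssocK).
- by abstract (intros; apply: eq_longHom; exact: comodAssocIK).
- by abstract (intros; apply: eq_longHom; exact: comodAssoc_nat).
- by abstract (intros; apply: eq_longHom; exact: comodLunit_nat).
- by abstract (intros; apply: eq_longHom; exact: comodRunit_nat).
- by abstract (intros; apply: eq_longHom; exact: comodPentagon).
- by abstract (intros; apply: eq_longHom; exact: comodTriangle).
Defined.

Lemma trivial_act_bilin (M : homComodule B) :
  bilin (fun (h : H) (m : M) => bcounit h *: maut M m).
Proof. by lin. Qed.
Definition trivial_act (M : homComodule B) : {bilinear H -> M -> M} :=
  mkbil (trivial_act_bilin M).

Lemma trivial_actE (M : homComodule B) h m :
  trivial_act M h m = bcounit h *: maut M m.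
Proof. by []. Qed.

Section TrivialFunctor.
Hypothesis tP : forall M : homComodule B, is_homLong (trivial_act M).

Lemma trivial_hom_act (M N : homComodule B) (f : comodHom M N) h m :
  f (trivial_act M h m) = trivial_act N h (f m).
Proof. by rewrite !trivial_actE linearZZ chom_aut. Qed.

Definition trivial_hom (M N : homComodule B) (f : comodHom M N) :
    longHom (HomLong (tP M)) (HomLong (tP N)) :=
  @LongHom _ _ _ (HomLong (tP M)) (HomLong (tP N)) f (trivial_hom_act f).

Definition trivial_functor : functor (comodCat B) longCat.
Proof.
refine (@Functor (comodCat B) longCat (fun M => HomLong (tP M)) trivial_hom _ _).
- by abstract (intros; apply: eq_longHom; apply: erefl).
- by abstract (intros; apply: eq_longHom; apply: erefl).
Defined.

End TrivialFunctor.
End LongMonoidal.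

Arguments trivial_act {k} H {B} M.
Arguments trivial_functor {k H B} tP.
Arguments comodCat {k} B.
Arguments longCat {k} H B.
Arguments comodMonoidal {k} B.
Arguments longMonoidal {k} H B.

(* Main.v *)
(** Since [ε(h1) ε(h2) = ε(h)], the trivial action of [H] on [M ⊗ N] is the
tensor product of the trivial actions, so the identity maps make the inclusion
monoidal.  For the braiding, coassociativity of the
coactions reduces every axiom to an identity in [B]: colinearity to the
commutation rule [⟨h1|g1⟩ g2 h2 = h1 g1 ⟨h2|g2⟩], the two hexagons to the
expansions of [⟨β h|g l⟩] and of [⟨h g|β l⟩], and symmetry to cotriangularity,
which then also yields invertibility. *)

Require Import Defs.
From mathcomp Require Import all_boot all_algebra.
Import GRing.Theory.
Local Open Scope ring_scope.
Local Open Scope cat_scope.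

(** * Comodules as dimodules: the trivial action and the inclusion functor *)

Section TrivialAction.
Variables (k : fieldType) (H B : homBialgebra k).

Lemma trivial_act_long (M : homComodule B) : is_homLong (trivial_act H M).
Proof.
split; first split.
- move=> h m; rewrite !trivial_actE linearZZ.
  by rewrite (hcoalg_counit_aut (bcoalgP H)).
- move=> g h m; rewrite !trivial_actE linearZZ scalerA bcounitM.
  by rewrite (hcoalg_counit_aut (bcoalgP H)).
- by move=> m; rewrite trivial_actE bcounit1 scale1r.
- move=> h m; rewrite trivial_actE linearZZ (hcomod_aut (mcomodP M)) tsumZ.
  apply: eq_tsum => b x; rewrite trivial_actE.
  by rewrite (hcoalg_counit_aut (bcoalgP H)) tpureZr.
Qed.

(** Apply [ε] to the counit law [ε(h1) h2 = α(h)] and use [ε ∘ α = ε]. *)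
Lemma bcounit_comul (h : H) :
  \tsum_(h1, h2 <- bcomul h) bcounit h1 * bcounit h2 = bcounit h.
Proof.
rewrite -[RHS](hcoalg_counit_aut (bcoalgP H)) -[in RHS](hcoalg_counitl (bcoalgP H)).
rewrite [RHS](@lin_tsum _ _ _ _ k^o (fun x : H => bcounit x : k^o)); last by lin.
by apply: eq_tsum => a b; rewrite linearZ.
Qed.

(** This makes the identity of [M ⊗ N] an [H]-linear map. Both actions apply [μ ⊗ ν] on pure
    tensors, so only the scalars need comparing. *)
Lemma trivial_tens_act (M N : homComodule B) h (t : tensor M N) :
  tact (HomLong (trivial_act_long M)) (HomLong (trivial_act_long N)) h t =
  trivial_act H (comodTens M N) h t.
Proof.
rewrite (@trivial_actE _ _ _ (comodTens M N)) [maut _]/(taut (maut M) (maut N)).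
move: t; tens_ext=> m n.
rewrite (@tactE _ _ _ (HomLong (trivial_act_long M))) tautE.
rewrite -[bcounit h in RHS]bcounit_comul.
rewrite (@lin_tsum _ _ _ k^o (tensor M N) (fun c => (c : k) *: (maut M m ⊗ maut N n))).
  by apply: eq_tsum => a b; rewrite -scalerA -tpureZr -tpureZl.
by lin.
Qed.

(** Definitional, since the structure map of the unit comodule is the identity. *)
Lemma trivial_unit_act h (x : k^o) :
  uact H h x = trivial_act H (comodUnit B) h x.
Proof. by []. Qed.

Definition trivial_tens (M N : homComodule B) :
    longHom (longTens (HomLong (trivial_act_long M)) (HomLong (trivial_act_long N)))
            (HomLong (trivial_act_long (comodTens M N))) :=
  @LongHom _ _ _ (longTens (HomLong (trivial_act_long M)) (HomLong (trivial_act_long N)))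
    (HomLong (trivial_act_long (comodTens M N)))
    (comodId (comodTens M N)) (@trivial_tens_act M N).

Definition trivial_unit :
    longHom (longUnit H B) (HomLong (trivial_act_long (comodUnit B))) :=
  @LongHom _ _ _ (longUnit H B) (HomLong (trivial_act_long (comodUnit B)))
    (comodId (comodUnit B)) trivial_unit_act.

(** The inverse of an [H]-linear bijection is [H]-linear, so invertibility of a dimodule map can be
    tested on comodules. *)
Lemma longHom_iso (X Y : homLong H B) (f : longHom X Y) (g : comodHom Y X) :
  comodComp g f = comodId X -> comodComp f g = comodId Y ->
  @is_iso (longCat H B) X Y f.
Proof.
move=> gf fg.
have gK : cancel f g by move=> x; rewrite -[g _]/(comodComp g f x) gf.
have fK : cancel g f by move=> x; rewrite -[f _]/(comodComp f g x) fg.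
by exists (longHom_inv gK fK); split; apply: eq_longHom.
Qed.

Lemma trivial_monoidal :
  @is_monoidal_functor (comodMonoidal B) (longMonoidal H B)
    (trivial_functor trivial_act_long) trivial_tens trivial_unit.
Proof.
split.
- move=> X Y.
  by apply: (longHom_iso _ _ (trivial_tens X Y) (comodId (comodTens X Y)));
    apply: (comodComp1 (comodId (comodTens X Y))).
- by apply: (longHom_iso _ _ trivial_unit (comodId (comodUnit B)));
    apply: (comodComp1 (comodId (comodUnit B))).
- move=> X X' Y Y' f g; apply: eq_longHom.
  by apply: eq_comodHom.
- move=> X Y Z; apply: eq_longHom.
  (* On underlying comodules the comparison maps are identities and the associators of the two
     categories coincide, so only unit laws remain. *)
  change (comodComp (comodComp (comodAssoc X Y Z) (comodId _))
            (comodTensHom (comodId (comodTens X Y)) (comodId Z)) =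
          comodComp (comodComp (comodId _)
            (comodTensHom (comodId X) (comodId (comodTens Y Z)))) (comodAssoc X Y Z)).
  by rewrite !comodTens_id !comodComp1 comod1Comp.
- move=> X; apply: eq_longHom.
  change (comodComp (comodComp (comodLunit X) (comodId _))
            (comodTensHom (comodId (comodUnit B)) (comodId X)) = comodLunit X).
  by rewrite comodTens_id !comodComp1.
- move=> X; apply: eq_longHom.
  change (comodComp (comodComp (comodRunit X) (comodId _))
            (comodTensHom (comodId X) (comodId (comodUnit B))) = comodRunit X).
  by rewrite comodTens_id !comodComp1.
Qed.

(** Forgetting the action recovers the comodule. *)
Lemma trivial_functor_inj :
  injective (trivial_functor (H := H) (B := B) trivial_act_long).
Proof. by move=> M N /(congr1 (@long_comod _ _ _)). Qed.

Lemma trivial_functor_faithful :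
  faithful (trivial_functor (H := H) (B := B) trivial_act_long).
Proof. by move=> M N f g /(congr1 (fun h => lhom (h : longHom _ _))). Qed.

End TrivialAction.

(** * Sweedler calculus for scalars and for two simultaneous coactions *)

Lemma tsumZl (k : fieldType) (M N V : lmodType k) (G : M -> N -> k) (v : V) t :
  tsum G t *: v = \tsum_(a, b <- t) G a b *: v.
Proof. exact: scaler_suml. Qed.

(** Turns iterated coactions on two elements into comultiplications, so that an identity in [B] can
    be applied. Reordering the sums makes the two coactions on [m] adjacent; coassociativity is then
    used for [m] and for [n] in turn. *)
Lemma sw_rho_coassoc2 (k : fieldType) (B : homBialgebra k) (M N : homComodule B)
    (P : lmodType k) (F : B -> B -> M -> B -> B -> N -> P) m n :
    (forall b d w, trilin (fun a c z => F a c z b d w)) ->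
    (forall a c z, trilin (F a c z)) ->
  \tsum_(a, x <- mrho m) \tsum_(b, y <- mrho n)
    \tsum_(c, z <- mrho x) \tsum_(d, w <- mrho y) F a c z b d w =
  \tsum_(a, x <- mrho m) \tsum_(b, y <- mrho n)
    \tsum_(a1, a2 <- bcomul a) \tsum_(b1, b2 <- bcomul b)
      F ((baut B)⁻¹ a1) a2 (maut M x) ((baut B)⁻¹ b1) b2 (maut N y).
Proof.
move=> hM hN.
transitivity (\tsum_(a, x <- mrho m) \tsum_(c, z <- mrho x)
    \tsum_(b, y <- mrho n) \tsum_(d, w <- mrho y) F a c z b d w).
  by apply: eq_tsum => a x; rewrite exchange_tsum.
rewrite (sw_rho_coassoc (F := fun a c z =>
  \tsum_(b, y <- mrho n) \tsum_(d, w <- mrho y) F a c z b d w)); last first.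
  (* The sums over [n] do not depend on the variables from [m], so linearity is checked termwise. *)
  split=> [a|c z]; [split=> [z|c]|]; do 2![apply: lin_tsum_f => ? ?].
  - exact: ((hM _ _ _).1 a).1.
  - exact: ((hM _ _ _).1 a).2.
  - exact: (hM _ _ _).2.
apply: eq_tsum => a x; rewrite [RHS]exchange_tsum; apply: eq_tsum => a1 a2.
by rewrite sw_rho_coassoc.
Qed.

Arguments sw_rho_coassoc2 {k B M N P} F.

(** * The braiding of comodules and its axioms *)

Section Braiding.
Variables (k : fieldType) (B : cqtHomHopf k).
Local Notation beta := (baut B).

Lemma bform_auti (a b : B) : bform (beta⁻¹ a) (beta⁻¹ b) = bform a b.
Proof. by rewrite -bform_aut !autVK. Qed.

Section Map.
Variables M N : homComodule B.

Lemma tbraid_linear : linear (fun t : tensor M N =>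
  \tsum_(m, n <- t) \tsum_(a, x <- mrho m) \tsum_(b, y <- mrho n)
    bform a b *: ((maut N)⁻¹ y ⊗ (maut M)⁻¹ x)).
Proof. by lin. Qed.
Definition tbraid : {linear tensor M N -> tensor N M} := mklin tbraid_linear.

Lemma tbraidE m n : tbraid (m ⊗ n) =
  \tsum_(a, x <- mrho m) \tsum_(b, y <- mrho n)
    bform a b *: ((maut N)⁻¹ y ⊗ (maut M)⁻¹ x).
Proof. by rewrite /tbraid /= tsum_pure //; lin. Qed.

End Map.
Arguments tbraid : simpl never.

Lemma tbraid_aut (M N : homComodule B) : forall t : tensor M N,
  tbraid M N (taut (maut M) (maut N) t) = taut (maut N) (maut M) (tbraid M N t).
Proof.
tens_ext=> m n; rewrite tautE !tbraidE.
rewrite sw_rho_aut; last by lin.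
rewrite lin_tsum; last by lin.
apply: eq_tsum => a x; rewrite sw_rho_aut; last by lin.
rewrite lin_tsum; last by lin.
by apply: eq_tsum => b y; rewrite linearZZ tautE bform_aut !autK !autVK.
Qed.

(** After coassociativity the two sides carry [⟨a1|b1⟩ b2 a2] and [a1 b1 ⟨a2|b2⟩], which the
    commutation rule equates. *)
Lemma tbraid_colinear (M N : homComodule B) : forall t : tensor M N,
  trho N M (tbraid M N t) = \tsum_(b, x <- trho M N t) b ⊗ tbraid M N x.
Proof.
tens_ext=> m n; rewrite tbraidE sw_trho; last by lin.
rewrite lin_tsum; last by lin.
transitivity (\tsum_(a, x <- mrho m) \tsum_(b, y <- mrho n)
    \tsum_(c, z <- mrho x) \tsum_(d, w <- mrho y)
      bform a b *: (beta⁻¹ (beta⁻¹ (beta⁻¹ (bmul d c))) ⊗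
        ((maut N)⁻¹ w ⊗ (maut M)⁻¹ z))).
  apply: eq_tsum => a x; rewrite lin_tsum; last by lin.
  apply: eq_tsum => b y; rewrite linearZZ trhoE.
  rewrite sw_rho_auti; last by lin.
  rewrite [RHS]exchange_tsum tsumZ; apply: eq_tsum => d w.
  rewrite sw_rho_auti; last by lin.
  rewrite tsumZ; apply: eq_tsum => c z.
  by rewrite -bmul_auti.
transitivity (\tsum_(a, x <- mrho m) \tsum_(b, y <- mrho n)
    \tsum_(c, z <- mrho x) \tsum_(d, w <- mrho y)
      bform c d *: (beta⁻¹ (beta⁻¹ (bmul a b)) ⊗
        ((maut N)⁻¹ w ⊗ (maut M)⁻¹ z))); last first.
  apply: eq_tsum => a x; apply: eq_tsum => b y; rewrite tbraidE.
  rewrite lin_tsum; last by lin.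
  apply: eq_tsum => c z; rewrite lin_tsum; last by lin.
  by apply: eq_tsum => d w; rewrite tpureZr.
rewrite (sw_rho_coassoc2 (fun a c z b d w => bform a b *:
   (beta⁻¹ (beta⁻¹ (beta⁻¹ (bmul d c))) ⊗ ((maut N)⁻¹ w ⊗ (maut M)⁻¹ z))));
    try by split; lin.
rewrite (sw_rho_coassoc2 (fun a c z b d w => bform c d *:
   (beta⁻¹ (beta⁻¹ (bmul a b)) ⊗ ((maut N)⁻¹ w ⊗ (maut M)⁻¹ z))));
    try by split; lin.
apply: eq_tsum => a x; apply: eq_tsum => b y.
(* Both sides are images under this linear map: two of the [β⁻¹] come from the coaction on a tensor
   product. The third comes on the left from the coactions of [μ⁻¹] and [ν⁻¹], on the right from the
   twist in coassociativity. *)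
pose L (u : B) := beta⁻¹ (beta⁻¹ (beta⁻¹ u)) ⊗ (y ⊗ x).
have hL : linear L by rewrite /L; lin.
have := congr1 L (bform_comm a b).
rewrite !(lin_tsum _ _ hL) => e.
etransitivity; first (etransitivity; last exact: e); apply: eq_tsum => a1 a2;
  rewrite (lin_tsum _ _ hL); apply: eq_tsum => b1 b2;
  by rewrite /L !linearZZ !autK tpureZl ?bform_auti -?bmul_auti.
Qed.

Definition comodBraid (M N : homComodule B) :
    comodHom (comodTens M N) (comodTens N M) :=
  @ComodHom _ _ (comodTens M N) (comodTens N M) (tbraid M N)
    (@tbraid_colinear M N) (@tbraid_aut M N).

Lemma comodBraidE (M N : homComodule B) (m : M) (n : N) :
  comodBraid M N (m ⊗ n) =
  \tsum_(a, x <- mrho m) \tsum_(b, y <- mrho n)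
    bform a b *: ((maut N)⁻¹ y ⊗ (maut M)⁻¹ x).
Proof. exact: tbraidE. Qed.

Lemma comodBraid_nat (M M' N N' : homComodule B)
    (f : comodHom M M') (g : comodHom N N') :
  comodComp (comodBraid M' N') (comodTensHom f g) =
  comodComp (comodTensHom g f) (comodBraid M N).
Proof.
apply: eq_comodHom; tens_ext=> m n.
rewrite !comodCompE comodTensE !comodBraidE.
rewrite sw_hom; last by lin.
rewrite lin_tsum; last by lin.
apply: eq_tsum => a x; rewrite sw_hom; last by lin.
rewrite lin_tsum; last by lin.
by apply: eq_tsum => b y; rewrite linearZZ tmapE !chom_auti.
Qed.

(** Coassociativity gathers the two pairings into [⟨a1|b1⟩ ⟨b2|a2⟩]; cotriangularity makes this
    [ε(a) ε(b)], and the counit law finishes. *)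
Lemma comodBraidK (cotri : cotriangular B) (M N : homComodule B) :
  comodComp (comodBraid N M) (comodBraid M N) = comodId (comodTens M N).
Proof.
apply: eq_comodHom; tens_ext=> m n; rewrite comodCompE comodBraidE.
transitivity (\tsum_(a, x <- mrho m) \tsum_(b, y <- mrho n)
    \tsum_(c, z <- mrho x) \tsum_(d, w <- mrho y)
      (bform a b * bform d c) *:
        ((maut M)⁻¹ ((maut M)⁻¹ z) ⊗ (maut N)⁻¹ ((maut N)⁻¹ w))).
  rewrite lin_tsum; last by lin.
  apply: eq_tsum => a x; rewrite lin_tsum; last by lin.
  apply: eq_tsum => b y; rewrite linearZZ comodBraidE.
  rewrite sw_rho_auti; last by lin.
  rewrite [RHS]exchange_tsum tsumZ; apply: eq_tsum => d w.
  rewrite sw_rho_auti; last by lin.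
  rewrite tsumZ; apply: eq_tsum => c z.
  by rewrite bform_auti scalerA.
rewrite (sw_rho_coassoc2 (fun a c z b d w => (bform a b * bform d c) *:
    ((maut M)⁻¹ ((maut M)⁻¹ z) ⊗ (maut N)⁻¹ ((maut N)⁻¹ w))));
    try by split; lin.
(* The counit law yields [μ(m)] rather than [m], so [m] is written as [μ⁻¹(μ(m))], and likewise
   [n]. *)
rewrite comodIdE -[in RHS](autK (maut M) m) -[in RHS](autK (maut N) n).
rewrite -(hcomod_counit (mcomodP M)) -(hcomod_counit (mcomodP N)).
rewrite (lin_tsum (L := fun u => (maut M)⁻¹ u ⊗ _)); last by lin.
apply: eq_tsum => a x.
rewrite (lin_tsum (L := fun u => _ ⊗ (maut N)⁻¹ u)); last by lin.
apply: eq_tsum => b y.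
rewrite !linearZZ tpureZl tpureZr scalerA -cotri tsumZl.
apply: eq_tsum => a1 a2; rewrite tsumZl; apply: eq_tsum => b1 b2.
by rewrite bform_auti !autK.
Qed.

(** The pairing of [x] with the product of the coefficients of [y] and [z] splits along the
    comultiplication on the [x] side; coassociativity for [x] then gives the two successive
    braidings. *)
Lemma comodBraid_hexagon1 (X Y Z : homComodule B) :
  comodComp (comodComp (comodAssoc Y Z X) (comodBraid X (comodTens Y Z)))
    (comodAssoc X Y Z) =
  comodComp (comodComp (comodTensHom (comodId Y) (comodBraid X Z))
    (comodAssoc Y X Z)) (comodTensHom (comodBraid X Y) (comodId Z)).
Proof.
apply: eq_comodHom; tens_ext=> t z; move: t; tens_ext=> x y.
rewrite !comodCompE comodAssocE (comodTensE (comodBraid X Y)) comodIdE.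
rewrite (comodBraidE X (comodTens Y Z)) comodBraidE.
transitivity (\tsum_(a, x' <- mrho x) \tsum_(b, y' <- mrho y)
  \tsum_(a1, a2 <- bcomul a) \tsum_(c, z' <- mrho z)
   (bform (beta⁻¹ a1) b * bform (beta⁻¹ a2) (beta c)) *:
     ((maut Y)⁻¹ ((maut Y)⁻¹ y') ⊗ (z' ⊗ (maut X)⁻¹ x'))).
  rewrite sw_rho_auti; last by lin.
  rewrite lin_tsum; last by lin.
  apply: eq_tsum => a x'.
  rewrite (@sw_mrho_tens _ _ Y Z); last by lin.
  rewrite lin_tsum; last by lin.
  apply: eq_tsum => b y'.
  rewrite sw_rho_aut; last by lin.
  rewrite lin_tsum; last by lin.
  rewrite [RHS]exchange_tsum; apply: eq_tsum => c z'.
  rewrite linearZZ [(maut (comodTens Y Z))⁻¹ _]tmapE comodAssocE.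
  (* The expansion rule needs a first argument of the form [β(h)]; here [h] is [β⁻¹(a)]. *)
  rewrite bform_auti -[in bform a](autVK beta a) bmul_auti autK bformMr tsumZl.
  rewrite sw_comul_auti; last by lin.
  by apply: eq_tsum => a1 a2; rewrite !autVK autK.
transitivity (\tsum_(a, x' <- mrho x) \tsum_(c, x'' <- mrho x')
  \tsum_(b, y' <- mrho y) \tsum_(d, z' <- mrho z)
   (bform a b * bform (beta⁻¹ c) (beta d)) *:
     ((maut Y)⁻¹ ((maut Y)⁻¹ y') ⊗ (z' ⊗ (maut X)⁻¹ ((maut X)⁻¹ x'')))).
  rewrite (sw_rho_coassoc (F := fun a c x'' =>
    \tsum_(b, y' <- mrho y) \tsum_(d, z' <- mrho z)
     (bform a b * bform (beta⁻¹ c) (beta d)) *: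
     ((maut Y)⁻¹ ((maut Y)⁻¹ y') ⊗ (z' ⊗ (maut X)⁻¹ ((maut X)⁻¹ x'')))));
    last by split; lin.
  apply: eq_tsum => a x'; rewrite exchange_tsum; apply: eq_tsum => a1 a2.
  by rewrite autK.
rewrite (lin_tsum (L := tpure^~ z)); last by lin.
rewrite !lin_tsum; [|by lin..].
apply: eq_tsum => a x'; rewrite exchange_tsum.
rewrite (lin_tsum (L := tpure^~ z)); last by lin.
rewrite !lin_tsum; [|by lin..].
apply: eq_tsum => b y'.
rewrite tpureZl !linearZZ comodAssocE (comodTensE (comodId Y)) comodIdE.
rewrite comodBraidE sw_rho_auti; last by lin.
rewrite lin_tsum; last by lin.
rewrite tsumZ; apply: eq_tsum => c x''.
rewrite sw_rho_aut; last by lin.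
rewrite lin_tsum; last by lin.
rewrite tsumZ; apply: eq_tsum => d z'.
by rewrite autK tpureZr scalerA.
Qed.

(** Now the coefficient of [z] splits. The rule for [⟨h g|β(l)⟩] pairs [g] with [l1], so [y] meets
    the first coefficient of [z], in agreement with [Y] crossing [Z] before [X] does. *)
Lemma comodBraid_hexagon2 (X Y Z : homComodule B) :
  comodComp (comodComp (comodAssocI Z X Y) (comodBraid (comodTens X Y) Z))
    (comodAssocI X Y Z) =
  comodComp (comodComp (comodTensHom (comodBraid X Z) (comodId Y))
    (comodAssocI X Z Y)) (comodTensHom (comodId X) (comodBraid Y Z)).
Proof.
apply: eq_comodHom; tens_ext=> x t; move: t; tens_ext=> y z.
rewrite !comodCompE comodAssocIE (comodTensE (comodId X)) comodIdE.
rewrite (comodBraidE (comodTens X Y) Z) comodBraidE.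
transitivity (\tsum_(b, y' <- mrho y) \tsum_(c, z' <- mrho z)
  \tsum_(c1, c2 <- bcomul c) \tsum_(a, x' <- mrho x)
   (bform b (beta⁻¹ c1) * bform (beta a) (beta⁻¹ c2)) *:
     ((maut Z)⁻¹ z' ⊗ x' ⊗ (maut Y)⁻¹ ((maut Y)⁻¹ y'))).
  rewrite (@sw_mrho_tens _ _ X Y); last by lin.
  (* The sum over [y] goes outside because the other composite braids [Y] with [Z] first. *)
  rewrite exchange_tsum lin_tsum; last by lin.
  apply: eq_tsum => b y'.
  rewrite sw_rho_aut; last by lin.
  rewrite lin_tsum; last by lin.
  transitivity (\tsum_(a, x' <- mrho x) \tsum_(c, z' <- mrho z)
    \tsum_(c1, c2 <- bcomul c)
     (bform b (beta⁻¹ c1) * bform (beta a) (beta⁻¹ c2)) *: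
       ((maut Z)⁻¹ z' ⊗ x' ⊗ (maut Y)⁻¹ ((maut Y)⁻¹ y'))).
    apply: eq_tsum => a x'; rewrite sw_rho_auti; last by lin.
    rewrite lin_tsum; last by lin.
    apply: eq_tsum => c z'.
    rewrite linearZZ [(maut (comodTens X Y))⁻¹ _]tmapE comodAssocIE.
    rewrite bform_auti -[in bform _ c](autVK beta c) bmul_auti autK bformMl tsumZl.
    rewrite sw_comul_auti; last by lin.
    by apply: eq_tsum => c1 c2; rewrite !autVK autK mulrC.
  rewrite exchange_tsum; apply: eq_tsum => c z'.
  by rewrite exchange_tsum.
transitivity (\tsum_(b, y' <- mrho y) \tsum_(c, z' <- mrho z)
  \tsum_(d, z'' <- mrho z') \tsum_(a, x' <- mrho x)
   (bform b c * bform (beta a) (beta⁻¹ d)) *: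
     ((maut Z)⁻¹ ((maut Z)⁻¹ z'') ⊗ x' ⊗ (maut Y)⁻¹ ((maut Y)⁻¹ y'))).
  apply: eq_tsum => b y'.
  rewrite (sw_rho_coassoc (F := fun c d z'' => \tsum_(a, x' <- mrho x)
   (bform b c * bform (beta a) (beta⁻¹ d)) *:
     ((maut Z)⁻¹ ((maut Z)⁻¹ z'') ⊗ x' ⊗ (maut Y)⁻¹ ((maut Y)⁻¹ y'))));
    last by split; lin.
  by apply: eq_tsum => c z'; apply: eq_tsum => c1 c2; rewrite autK.
rewrite (lin_tsum (L := tpure x)); last by lin.
rewrite !lin_tsum; [|by lin..].
apply: eq_tsum => b y'.
rewrite (lin_tsum (L := tpure x)); last by lin.
rewrite !lin_tsum; [|by lin..].
apply: eq_tsum => c z'; rewrite exchange_tsum.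
rewrite tpureZr !linearZZ comodAssocIE (comodTensE (comodBraid X Z)) comodIdE.
rewrite comodBraidE sw_rho_aut; last by lin.
rewrite (lin_tsum (L := tpure^~ _)); last by lin.
rewrite tsumZ; apply: eq_tsum => a x'.
rewrite sw_rho_auti; last by lin.
rewrite (lin_tsum (L := tpure^~ _)); last by lin.
rewrite tsumZ; apply: eq_tsum => d z''.
by rewrite autK tpureZl scalerA.
Qed.

Lemma comodBraid_iso (cotri : cotriangular B) (M N : homComodule B) :
  @is_iso (comodCat B) (comodTens M N) (comodTens N M) (comodBraid M N).
Proof. by exists (comodBraid N M); split; apply: comodBraidK. Qed.

Definition comodBraiding (cotri : cotriangular B) : braiding (comodMonoidal B) :=
  @Braiding (comodMonoidal B) comodBraid (comodBraid_iso cotri) comodBraid_nat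
    comodBraid_hexagon1 comodBraid_hexagon2.

End Braiding.

(** Being a monoidal subcategory is expressed by a faithful functor, injective on objects, whose
    comparison maps act as identities on the underlying spaces. *)
Theorem proposition4p2 (k : fieldType) (H : homHopf k) (B : cqtHomHopf k)
    (cotri : cotriangular B) :
  exists tP : (forall M : homComodule B, is_homLong (trivial_act H M)),
  let J : functor (comodMonoidal B) (longMonoidal H B) := trivial_functor tP in
  [/\ injective J,
      faithful J,
      exists (phi : forall M N, mor (J M ⊠ J N) (J (M ⊠ N)))
             (phi0 : mor (munit (longMonoidal H B)) (J (munit (comodMonoidal B)))),
        [/\ is_monoidal_functor J phi phi0,
            forall (M N : homComodule B) (t : tensor M N),
              (phi M N : longHom _ _) t = t
          & forall x : k^o, (phi0 : longHom _ _) x = x]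
    & exists c : braiding (comodMonoidal B),
        symmetric_braiding c /\
        forall (M N : homComodule B) (m : M) (n : N),
          (c M N : comodHom (comodTens M N) (comodTens N M)) (m ⊗ n) =
          \tsum_(a, x <- mrho m) \tsum_(b, y <- mrho n)
            bform a b *: ((maut N)⁻¹ y ⊗ (maut M)⁻¹ x)].
Proof.
exists (@trivial_act_long k H B) => J; split.
- exact: trivial_functor_inj.
- exact: trivial_functor_faithful.
- exists (@trivial_tens k H B), (@trivial_unit k H B).
  by split=> //; apply: trivial_monoidal.
- exists (comodBraiding k B cotri); split; first exact: comodBraidK k B cotri.
  exact: comodBraidE.
Qed.
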